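(* Let $g \geq 3$ and let $K = \pi_1(\Sigma_g)$. Let $\upsilon : K \to K$ be (an automorphism representing) the generator of a cyclic subgroup of order $4g+2$ of $\mathrm{Mod}_g$, and let $\Pi = K \rtimes_{\upsilon} \mathbb{Z}$ be the fundamental group of the corresponding mapping torus. Let $\delta : K \to K$ be an automorphism induced by a Dehn twist along a nonseparating curve in $\Sigma_g$, chosen so that the classes of $\upsilon$ and $\delta \upsilon \delta^{-1}$ generate $\mathrm{Mod}_g$. Let $\Pi *_{\delta} \Pi$ be the amalgamated free product determined by $\delta$. Then the Putman--Wieland conjecture $\mathrm{NFO}(g,0,0)$ holds if and only if the surface-by-$F_2$ group $\Pi *_{\delta} \Pi$ fails to virtually algebraically fiber.
   Context: $\Sigma_g$ is the closed orientable surface of genus $g$. $\mathrm{Mod}_g \unlhd \mathrm{Out}(K)$ is its mapping class group (orientation-preserving), viewed as an index-two subgroup of $\mathrm{Out}(K)$. It is known (Korkmaz) that for $g\ge 3$, $\mathrm{Mod}_g$ is generated by two elements of order $4g+2$ that are conjugate to each other by a Dehn twist along a nonseparating curve; any two cyclic subgroups of order $4g+2$ in $\mathrm{Mod}_g$ are conjugate, so $\Pi$ is well-defined up to isomorphism. $\Pi *_\delta \Pi$ is the free product of two copies of $\Pi = K\rtimes_\upsilon \mathbb{Z}$ amalgamated along their normal subgroups $K$, where the subgroup $K$ of the first copy is identified with the subgroup $K$ of the second copy via $\delta$. It is an extension of the free group $F_2$ by $K$, whose monodromy $F_2 \to \mathrm{Mod}_g$ sends the two free generators to the class of $\upsilon$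 and a conjugate of it by the Dehn twist. A group algebraically fibers if it admits an epimorphism to $\mathbb{Z}$ with finitely generated kernel; it virtually algebraically fibers if some finite index subgroup algebraically fibers. $\mathrm{Mod}_g^1$ denotes the mapping class group of a surface of genus $g$ with one puncture, identified with the index-two subgroup of $\mathrm{Aut}(\pi_1(\Sigma_g))$ of automorphisms induced by orientation-preserving homeomorphisms. If $\widetilde K \unlhd K$ is characteristic, $\mathrm{Mod}_g^1$ acts on $\widetilde K$ by restriction, hence on $H_1(\widetilde K;\mathbb{Q})$. $\mathrm{NFO}(g,0,0)$ is the statement: for every finite index characteristic subgroup $\widetilde K \unlhd K = \pi_1(\Sigma_g)$ and every nonzero vector $v \in H_1(\widetilde K;\mathbb{Q})$, the $\mathrm{Mod}_g^1$-orbit of $v$ is infinite. *)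

(* Defs.v *)
From HB Require Import structures.
From mathcomp Require Import all_boot all_order all_algebra.
From mathcomp Require Import boolp classical_sets cardinality.
From mathcomp Require Import freeg.

Set Implicit Arguments.
Unset Strict Implicit.
Unset Printing Implicit Defensive.

Import GRing.Theory.

Local Open Scope classical_set_scope.
Local Open Scope quotient_scope.
Local Open Scope group_scope.

Section Subgroups.
Variable G : groupType.

Definition subgroup (H : set G) :=
  [/\ H 1, forall x y, H x -> H y -> H (x * y) & forall x, H x -> H x^-1].

Definition normal_subgroup (N : set G) :=
  subgroup N /\ forall x y, N x -> N (x ^ y).

Definition generated (S : set G) : set G := smallest subgroup S.

Definition normal_closure (S : set G) : set G := smallest normal_subgroup S.

Definition finitely_generated (H : set G) :=
  exists2 S : set G, finite_set S & generated S = H.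

Definition finite_index (H : set G) :=
  finite_set [set [set x * h | h in H] | x in setT].

Definition has_order (x : G) (n : nat) :=
  (0 < n)%N /\ forall m : nat, x ^+ m = 1 <-> (n %| m)%N.

(* Only the restriction of f to H matters: it is an epimorphism H -> Z whose
   kernel is finitely generated. *)
Definition algebraically_fibers (H : set G) :=
  exists f : G -> int,
    [/\ forall x y, H x -> H y -> f (x * y) = (f x + f y)%R,
        forall n : int, exists2 x, H x & f x = n
      & finitely_generated [set x | H x /\ f x = 0%R]].

Definition virtually_algebraically_fibers :=
  exists H : set G, [/\ subgroup H, finite_index H & algebraically_fibers H].

Lemma normal_closure_normal (S : set G) : normal_subgroup (normal_closure S).
Proof.
split; first split.
- by move=> N [[[]]].
- by move=> x y Hx Hy N HN; have [[[_ NM _] _] _] := HN;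
     apply: NM; [exact: Hx | exact: Hy].
- by move=> x Hx N HN; have [[[_ _ NV] _] _] := HN; apply: NV; exact: Hx.
- by move=> x y Hx N HN; have [[_ NJ] _] := HN; apply: NJ; exact: Hx.
Qed.

End Subgroups.

Section FreeGroup.
Variable X : choiceType.

(* The letter (x, false) stands for x and (x, true) for its inverse. *)
Definition word : Type := seq (X * bool).
HB.instance Definition _ := Choice.on word.

Inductive word_eq : word -> word -> Prop :=
| WordRefl u : word_eq u u
| WordSym u v : word_eq u v -> word_eq v u
| WordTrans u v w : word_eq u v -> word_eq v w -> word_eq u w
| WordCancel u v x b : word_eq (u ++ (x, b) :: (x, ~~ b) :: v) (u ++ v).

Definition word_eqb (u v : word) := `[< word_eq u v >].

Lemma word_eqb_refl : reflexive word_eqb.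
Proof. by move=> u; apply/asboolP; exact: WordRefl. Qed.
Lemma word_eqb_sym : symmetric word_eqb.
Proof. by move=> u v; apply/asboolP/asboolP; exact: WordSym. Qed.
Lemma word_eqb_trans : transitive word_eqb.
Proof.
by move=> v u w /asboolP uv /asboolP vw; apply/asboolP; exact: WordTrans vw.
Qed.

Canonical word_equiv :=
  EquivRel word_eqb word_eqb_refl word_eqb_sym word_eqb_trans.

Definition free_group := {eq_quot word_equiv}.
HB.instance Definition _ := Choice.on free_group.
HB.instance Definition _ := EqQuotient.on free_group.

Definition winv (u : word) : word := rev [seq (p.1, ~~ p.2) | p <- u].

Lemma word_eq_cat u u' v v' :
  word_eq u u' -> word_eq v v' -> word_eq (u ++ v) (u' ++ v').
Proof.
move=> uu' vv'; apply: (@WordTrans _ (u' ++ v)).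
  elim: uu' => {u u'} [u|u w _ IH|u w t _ IH1 _ IH2|u w x b].
  - exact: WordRefl.
  - exact: WordSym.
  - exact: WordTrans IH2.
  - by rewrite -!catA /=; exact: WordCancel.
elim: vv' => {v v'} [v|v w _ IH|v w t _ IH1 _ IH2|v w x b].
- exact: WordRefl.
- exact: WordSym.
- exact: WordTrans IH2.
- by rewrite !catA; exact: WordCancel.
Qed.

Lemma word_eq_inv u v : word_eq u v -> word_eq (winv u) (winv v).
Proof.
elim=> {u v} [u|u w _ IH|u w t _ IH1 _ IH2|u w x b].
- exact: WordRefl.
- exact: WordSym.
- exact: WordTrans IH2.
- rewrite /winv !map_cat !rev_cat /= !rev_cons -!cats1 -!catA /=.
  by rewrite negbK; exact: WordCancel.
Qed.

Lemma word_eq_mulV u : word_eq (winv u ++ u) [::].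
Proof.
elim: u => [|[x b] u IH]; first exact: WordRefl.
rewrite /winv /= rev_cons -cats1 -catA /= -{2}(negbK b).
exact: WordTrans (WordCancel _ _ _ _) IH.
Qed.

Lemma winvK : involutive winv.
Proof.
move=> u; rewrite /winv map_rev revK -map_comp -[RHS]map_id.
by apply: eq_map => -[x b] /=; rewrite negbK.
Qed.

Lemma free_piP u v : word_eq u v <-> \pi_free_group u = \pi_free_group v.
Proof.
split=> [uv|/eqmodP/asboolP//].
by apply/eqmodP; apply/asboolP.
Qed.

Definition free_mul (p q : free_group) : free_group :=
  \pi_free_group (repr p ++ repr q).
Definition free_inv (p : free_group) : free_group := \pi_free_group (winv (repr p)).
Definition free_one : free_group := \pi_free_group [::].

Lemma repr_pi_eq u : word_eq (repr (\pi_free_group u)) u.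
Proof. by apply/free_piP; rewrite reprK. Qed.

Lemma free_mulE u v :
  free_mul (\pi_free_group u) (\pi_free_group v) = \pi_free_group (u ++ v).
Proof. by apply/free_piP/word_eq_cat; exact: repr_pi_eq. Qed.

Lemma free_invE u : free_inv (\pi_free_group u) = \pi_free_group (winv u).
Proof. by apply/free_piP/word_eq_inv; exact: repr_pi_eq. Qed.

Lemma free_ind (P : free_group -> Prop) :
  (forall u, P (\pi_free_group u)) -> forall p, P p.
Proof. by move=> Ppi p; rewrite -[p]reprK; exact: Ppi. Qed.

Lemma free_mulA : associative free_mul.
Proof.
by elim/free_ind=> u; elim/free_ind=> v; elim/free_ind=> w; rewrite !free_mulE catA.
Qed.
Lemma free_mul1 : left_id free_one free_mul.
Proof. by elim/free_ind=> u; rewrite free_mulE. Qed.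
Lemma free_mulr1 : right_id free_one free_mul.
Proof. by elim/free_ind=> u; rewrite free_mulE cats0. Qed.
Lemma free_mulV : left_inverse free_one free_inv free_mul.
Proof.
elim/free_ind=> u; rewrite free_invE free_mulE.
by apply/free_piP/word_eq_mulV.
Qed.
Lemma free_mulrV : right_inverse free_one free_inv free_mul.
Proof.
elim/free_ind=> u; rewrite free_invE free_mulE; apply/free_piP.
by rewrite -{1}(winvK u); exact: word_eq_mulV.
Qed.

HB.instance Definition _ := isGroup.Build free_group
  free_mulA free_mul1 free_mulr1 free_mulV free_mulrV.

Definition free_gen (x : X) : free_group := \pi_free_group [:: (x, false)].

End FreeGroup.

(* G modulo the normal closure of S. *)
Section Quotient.
Variables (G : groupType) (S : set G).

Definition cong (x y : G) : bool := `[< normal_closure S (x^-1 * y) >].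

Lemma cong_refl : reflexive cong.
Proof.
move=> x; apply/asboolP; rewrite mulVg.
by have [[]] := normal_closure_normal S.
Qed.
Lemma cong_sym : symmetric cong.
Proof.
have imp x y : cong x y -> cong y x.
  move=> /asboolP xy; apply/asboolP.
  have [[_ _ NV] _] := normal_closure_normal S.
  by have := NV _ xy; rewrite invgM invgK.
by move=> x y; apply/idP/idP; exact: imp.
Qed.
Lemma cong_trans : transitive cong.
Proof.
move=> y x z /asboolP xy /asboolP yz; apply/asboolP.
have [[_ NM _] _] := normal_closure_normal S.
by have := NM _ _ xy yz; rewrite mulgA mulgK.
Qed.

Canonical cong_equiv := EquivRel cong cong_refl cong_sym cong_trans.

Definition quot := {eq_quot cong_equiv}.
HB.instance Definition _ := Choice.on quot.
HB.instance Definition _ := EqQuotient.on quot.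

Definition proj (x : G) : quot := \pi_quot x.

Lemma projP x y : normal_closure S (x^-1 * y) <-> proj x = proj y.
Proof.
by split=> [xy|/eqmodP/asboolP//]; apply/eqmodP; apply/asboolP.
Qed.

Definition quot_mul (p q : quot) : quot := proj (repr p * repr q).
Definition quot_inv (p : quot) : quot := proj (repr p)^-1.
Definition quot_one : quot := proj 1.

Lemma repr_proj x : normal_closure S ((repr (proj x))^-1 * x).
Proof. by apply/projP; rewrite /proj reprK. Qed.

Lemma quot_mulE x y : quot_mul (proj x) (proj y) = proj (x * y).
Proof.
apply/projP; have [[_ NM _] NJ] := normal_closure_normal S.
have := NM _ _ (repr_proj y) (NJ _ y (repr_proj x)).
by rewrite /conjg invgM !mulgA mulgK.
Qed.

Lemma quot_invE x : quot_inv (proj x) = proj x^-1.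
Proof.
apply/projP; have [[_ _ NV] NJ] := normal_closure_normal S.
have := NJ _ x^-1 (NV _ (repr_proj x)).
by rewrite /conjg invgM !invgK !mulgA mulgV mul1g.
Qed.

Lemma quot_ind (P : quot -> Prop) : (forall x, P (proj x)) -> forall p, P p.
Proof. by move=> Pproj p; rewrite -[p]reprK; exact: Pproj. Qed.

Lemma quot_mulA : associative quot_mul.
Proof.
by elim/quot_ind=> x; elim/quot_ind=> y; elim/quot_ind=> z;
   rewrite !quot_mulE mulgA.
Qed.
Lemma quot_mul1 : left_id quot_one quot_mul.
Proof. by elim/quot_ind=> x; rewrite quot_mulE mul1g. Qed.
Lemma quot_mulr1 : right_id quot_one quot_mul.
Proof. by elim/quot_ind=> x; rewrite quot_mulE mulg1. Qed.
Lemma quot_mulV : left_inverse quot_one quot_inv quot_mul.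
Proof. by elim/quot_ind=> x; rewrite quot_invE quot_mulE mulVg. Qed.
Lemma quot_mulrV : right_inverse quot_one quot_inv quot_mul.
Proof. by elim/quot_ind=> x; rewrite quot_invE quot_mulE mulgV. Qed.

HB.instance Definition _ := isGroup.Build quot
  quot_mulA quot_mul1 quot_mulr1 quot_mulV quot_mulrV.

End Quotient.

Section Automorphisms.
Variable G : groupType.

Record aut := Aut {
  aut_fun :> G -> G;
  aut_bwd : G -> G;
  autM : {morph aut_fun : x y / x * y};
  autK : cancel aut_fun aut_bwd;
  autVK : cancel aut_bwd aut_fun }.

HB.instance Definition _ := gen_eqMixin aut.
HB.instance Definition _ := gen_choiceMixin aut.

Lemma aut_ext (f g : aut) : f =1 g -> f = g.
Proof.
case: f g => [f f' fM fK fK'] [g g' gM gK gK'] /= fg.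
have {fg} ? : f = g by apply/funext.
subst g; have ? : f' = g'.
  by apply/funext => x; rewrite -{1}(gK' x) fK.
by subst g'; congr Aut; exact: Prop_irrelevance.
Qed.

Lemma aut_bwdM (f : aut) : {morph aut_bwd f : x y / x * y}.
Proof.
by move=> x y; apply: (can_inj (@autK f)); rewrite autM !autVK.
Qed.

Definition aut_one : aut :=
  @Aut id id (fun _ _ => erefl) (fun _ => erefl) (fun _ => erefl).
Definition aut_inv (f : aut) : aut :=
  @Aut (aut_bwd f) f (aut_bwdM f) (@autVK f) (@autK f).

Lemma aut_compM (f g : aut) : {morph f \o g : x y / x * y}.
Proof. by move=> x y; rewrite /= !autM. Qed.

Definition aut_mul (f g : aut) : aut :=
  @Aut (f \o g) (aut_bwd g \o aut_bwd f) (aut_compM f g)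
    (can_comp (@autK f) (@autK g)) (can_comp (@autVK g) (@autVK f)).

Lemma aut_mulA : associative aut_mul.
Proof. by move=> f g h; apply: aut_ext. Qed.
Lemma aut_mul1 : left_id aut_one aut_mul.
Proof. by move=> f; apply: aut_ext. Qed.
Lemma aut_mulr1 : right_id aut_one aut_mul.
Proof. by move=> f; apply: aut_ext. Qed.
Lemma aut_mulV : left_inverse aut_one aut_inv aut_mul.
Proof. by move=> f; apply: aut_ext => x /=; rewrite autK. Qed.
Lemma aut_mulrV : right_inverse aut_one aut_inv aut_mul.
Proof. by move=> f; apply: aut_ext => x /=; rewrite autVK. Qed.

(* The product of aut is composition, (f * g) x = f (g x). *)
HB.instance Definition _ := isGroup.Build aut
  aut_mulA aut_mul1 aut_mulr1 aut_mulV aut_mulrV.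

Definition inner : set aut :=
  [set f | exists k, forall x, f x = k * x * k^-1].

(* Inner automorphisms already form a normal subgroup. *)
Definition Out := quot inner.
HB.instance Definition _ := Group.on Out.

Definition out (f : aut) : Out := proj inner f.

Definition characteristic (H : set G) := forall f : aut, f @` H = H.

End Automorphisms.

Section IntegerPowers.
Variable G : groupType.

Definition zpow (x : G) (n : int) : G :=
  match n with Posz m => x ^+ m | Negz m => x ^- m.+1 end.

Lemma zpowS x n : zpow x (n + 1)%R = zpow x n * x.
Proof.
case: n => [m|[|m]].
- by rewrite -PoszD addn1 /= expgSr.
- by rewrite /= expg1 mulVg.
- have -> : (Negz m.+1 + 1 = Negz m)%R.
    by rewrite !NegzE -[m.+2]addn1 PoszD opprD addrNK.
  by rewrite /= [in RHS]expgS invgM mulgVK.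
Qed.

Lemma zpowD x m n : zpow x (m + n)%R = zpow x m * zpow x n.
Proof.
elim/int_ind: n => [|n IH|n IH]; first by rewrite addr0 mulg1.
- by rewrite -addn1 PoszD addrA !zpowS IH mulgA.
- apply: (can_inj (mulgK x)).
  by rewrite -zpowS -mulgA -zpowS -addn1 PoszD opprD -!addrA addNr addr0 IH.
Qed.

End IntegerPowers.

Section SemidirectZ.
Variable G : groupType.

(* G x|_f Z: the generator t = (1, 1) satisfies t k t^-1 = f k for k in G. *)
Definition semidirectZ (f : aut G) : Type := (G * int)%type.
HB.instance Definition _ f := Choice.on (semidirectZ f).

Variable f : aut G.

Definition sd_mul (p q : semidirectZ f) : semidirectZ f :=
  (p.1 * zpow f p.2 q.1, (p.2 + q.2)%R).
Definition sd_one : semidirectZ f := (1, 0%R).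
Definition sd_inv (p : semidirectZ f) : semidirectZ f :=
  (zpow f (- p.2)%R p.1^-1, (- p.2)%R).

Lemma aut1 (h : aut G) : h 1 = 1.
Proof. by apply: (mulgI (h 1)); rewrite -autM !mulg1. Qed.
Lemma zpow_add m n x : zpow f (m + n)%R x = zpow f m (zpow f n x).
Proof. by rewrite zpowD. Qed.

Lemma sd_mulA : associative sd_mul.
Proof.
by move=> [x m] [y n] [z p]; rewrite /sd_mul /= autM zpow_add mulgA addrA.
Qed.
Lemma sd_mul1 : left_id sd_one sd_mul.
Proof. by move=> [x m]; rewrite /sd_mul /= mul1g add0r. Qed.
Lemma sd_mulr1 : right_id sd_one sd_mul.
Proof. by move=> [x m]; rewrite /sd_mul /= aut1 mulg1 addr0. Qed.
Lemma sd_mulV : left_inverse sd_one sd_inv sd_mul.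
Proof.
by move=> [x m]; rewrite /sd_mul /sd_inv /= -autM mulVg aut1 addNr.
Qed.
Lemma sd_mulrV : right_inverse sd_one sd_inv sd_mul.
Proof.
by move=> [x m]; rewrite /sd_mul /sd_inv /= -zpow_add subrr /= mulgV.
Qed.

HB.instance Definition _ := isGroup.Build (semidirectZ f)
  sd_mulA sd_mul1 sd_mulr1 sd_mulV sd_mulrV.

Definition sd_inj (k : G) : semidirectZ f := (k, 0%R).

End SemidirectZ.

Section Amalgam.
Variables (A B C : groupType) (i : A -> B) (j : A -> C).

Let inB (x : B) : free_group (B + C)%type := free_gen (inl x).
Let inC (x : C) : free_group (B + C)%type := free_gen (inr x).

(* The multiplication tables of B and C, together with i a = j a for a in A. *)
Definition amalgam_rel : set (free_group (B + C)%type) :=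
  [set w | (exists x y, w = (inB (x * y))^-1 * (inB x * inB y))
        \/ (exists x y, w = (inC (x * y))^-1 * (inC x * inC y))
        \/ (exists a, w = (inB (i a))^-1 * inC (j a))].

Definition amalgam := quot amalgam_rel.
HB.instance Definition _ := Group.on amalgam.

End Amalgam.

Section GroupHomology.
Variables (G : groupType) (R : comNzRingType).

Local Open Scope ring_scope.

(* Differentials of the (unnormalised) bar complex with trivial coefficients R;
   d1 : C_1 -> C_0 is zero. *)
Definition bar_d2 : {freeg (G * G) / R} -> {freeg G / R} :=
  fglift (fun p => << p.2 >> - << (p.1 * p.2)%g >> + << p.1 >>).

Definition bar_d3 : {freeg (G * G * G) / R} -> {freeg (G * G) / R} :=
  fglift (fun p => let: (x, y, z) := p in
    << (y, z) >> - << ((x * y)%g, z) >> + << (x, (y * z)%g) >> - << (x, y) >>).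

Definition chain1_map (f : G -> G) : {freeg G / R} -> {freeg G / R} :=
  fglift (fun x => << f x >>).

Definition chain2_map (f : G -> G) :
    {freeg (G * G) / R} -> {freeg (G * G) / R} :=
  fglift (fun p => << (f p.1, f p.2) >>).

Definition acts_trivially_on_H2 (f : G -> G) :=
  forall c, bar_d2 c = 0 -> exists d, chain2_map f c - c = bar_d3 d.

(* For a subgroup H of G, the chains of H are the chains of G supported on H,
   and an element of H_1(H; R) is a coset of the 1-boundaries of H. *)
Definition C1 (H : set G) : set {freeg G / R} :=
  [set c | forall x, x \in dom c -> H x].
Definition C2 (H : set G) : set {freeg (G * G) / R} :=
  [set c | forall p, p \in dom c -> H p.1 /\ H p.2].
Definition B1 (H : set G) : set {freeg G / R} := bar_d2 @` C2 H.

Definition H1_class (H : set G) (c : {freeg G / R}) : set {freeg G / R} :=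
  [set c' | C1 H c' /\ B1 H (c' - c)].
Definition H1 (H : set G) : set (set {freeg G / R}) := H1_class H @` C1 H.

Definition H1_act (f : G -> G) (v : set {freeg G / R}) : set {freeg G / R} :=
  chain1_map f @` v.

End GroupHomology.

Section Surface.
Variable g : nat.

Definition surface_rel : set (free_group ('I_g + 'I_g)%type) :=
  let a i := free_gen (inl i) in let b i := free_gen (inr i) in
  [set \prod_(i < g) (a i * b i * (a i)^-1 * (b i)^-1)].

(* The fundamental group of the closed orientable surface of genus g. *)
Definition surface_group := quot surface_rel.
HB.instance Definition _ := Group.on surface_group.

Definition sa (i : 'I_g) : surface_group :=
  proj surface_rel (free_gen (inl i)).
Definition sb (i : 'I_g) : surface_group :=
  proj surface_rel (free_gen (inr i)).

(* The surface is aspherical, so H_2(K; Z) is its second homology group: an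
   orientation-preserving homeomorphism is one that fixes the fundamental
   class.  By Dehn-Nielsen-Baer every automorphism of K is induced by a
   homeomorphism. *)
Definition Mod1 : set (aut surface_group) :=
  [set f | acts_trivially_on_H2 int f].

Definition Mod : set (Out surface_group) := @out surface_group @` Mod1.

(* The twist along the nonseparating curve b_0, which a_0 crosses once; it
   fixes the complement of this curve. *)
Definition standard_twist (t : aut surface_group) :=
  forall i : 'I_g, t (sb i) = sb i /\
    t (sa i) = if val i == 0%N then sa i * sb i else sa i.

(* Every nonseparating simple closed curve is the image of b_0 under some
   homeomorphism h (possibly orientation-reversing, whence twists of either
   handedness), and the twist along h(b_0) is the conjugate by h of that along
   b_0.  An automorphism is only determined by the twist up to inner ones. *)
Definition nonseparating_dehn_twist (d : aut surface_group) :=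
  exists t h : aut surface_group,
    standard_twist t /\ out d = out (h * t * h^-1).

Definition NFO :=
  forall H : set surface_group,
    subgroup H -> finite_index H -> characteristic H ->
  forall v : set {freeg surface_group / rat},
    H1 H v -> v <> H1_class H 0%R ->
    infinite_set [set H1_act f v | f in Mod1].

(* Pi *_d Pi: the element k of K in the first factor is identified with d k in
   the second one.  Identifying K with the subgroup K of the second factor, the
   stable letters of the two factors then act on K as d * u * d^-1 and u. *)
Definition amalgam_along (u d : aut surface_group) :=
  amalgam (sd_inj u) (fun k => sd_inj u (d k)).
HB.instance Definition _ u d := Group.on (amalgam_along u d).

End Surface.

Arguments Mod1 g : clear implicits.
Arguments Mod g : clear implicits.

(* Main.v *)
Require Import Defs.
From HB Require Import structures.
From mathcomp Require Import all_boot all_order all_algebra perm.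
From mathcomp Require Import boolp classical_sets cardinality.
From mathcomp Require Import freeg ring lra zify.

(** Let K be the surface group and F the free group on the two stable letters of
    the amalgam.  The amalgam is a semidirect product K x| F (amalgam_iso).  Since
    the two monodromies generate the mapping class group, Mod1 and the
    automorphisms of K induced by K x| F agree up to inner automorphisms
    (Mod1_monodromy, monodromy_Mod1).  The failure of NFO and the existence of a
    virtual fibering are both equivalent to a third condition: some characteristic
    subgroup H of finite index in K has a nonzero homomorphism H -> Q whose orbit
    under these automorphisms is finite.

    From homology classes to homomorphisms.  The rational homology H_1(H) is the
    dual of Hom(H, Q) (B1P, hom_functional_chain), and a nondegenerate form on
    Hom(H, Q) that is invariant under Mod1 (characteristic_form) matches the
    classes with a finite orbit with the homomorphisms with a finite orbit.  The
    form is the intersection form of the covering surface with group H.  A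
    homomorphism on H extends to a function on K whose increments A(xk) - A(x)
    depend only on k and the coset of x; the cup product of two such functions,
    summed over the cosets, is a 2-cocycle on K, which is integrated over an
    explicit fundamental cycle.  Invariance holds because Mod1 fixes the class of
    that cycle.  Nondegeneracy is Poincare duality (intersection_nondegenerate):
    every function on the edges of the coset graph of H has a potential on the
    Cayley tree of the free group that presents K, the integral becomes the value
    of a potential at the relator, and evaluation on single edges shows that a
    class orthogonal to everything is constant around the polygon.

    From fiberings to homomorphisms.  Let f be a fibering of a subgroup of finite
    index of K x| F.  It does not vanish on K, since otherwise a subgroup of finite
    index of F would fiber, which a count of mod 2 homomorphisms excludes
    (free_not_fibering).  Its restriction to a suitable H is fixed by a subgroup
    of finite index, so its orbit is finite (fibering_not_NFO).

    From homomorphisms to fiberings.  A homomorphism with a finite orbit is a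
    multiple of an epimorphism a : H -> Z (integral_character) and is fixed by a
    subgroup St of finite index in F.  Let lambda be the total exponent of the
    stable letters.  Then a + c lambda is a fibering of H x| St when c is large
    (stabilizer_fibers): if a k = 1 and t is in St, then conjugation by k^-M t with M large moves
    suitable finitely generated pieces of the kernel of a in a definite direction,
    so that finitely many elements and this conjugation generate the whole kernel
    (torus_kernel). *)

Set Implicit Arguments.
Unset Strict Implicit.
Unset Printing Implicit Defensive.

Import GRing.Theory Num.Theory Order.TTheory.

Local Open Scope classical_set_scope.
Local Open Scope quotient_scope.
Local Open Scope group_scope.

(** * Homomorphisms, generation and presentations *)

Section Morphisms.
Variables (G G' : groupType) (f : G -> G').
Hypothesis fM : {morph f : x y / x * y}.

Lemma morph1 : f 1 = 1.
Proof. by apply: (mulgI (f 1)); rewrite -fM !mulg1. Qed.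

Lemma morphV : {morph f : x / x^-1}.
Proof. by move=> x; apply: (mulgI (f x)); rewrite -fM !mulgV morph1. Qed.

Lemma morphX n : {morph f : x / x ^+ n}.
Proof. by move=> x; elim: n => [|n IH]; rewrite ?morph1 // !expgS fM IH. Qed.

Lemma morph_zpow x n : f (zpow x n) = zpow (f x) n.
Proof. by case: n => n /=; rewrite ?morphV morphX. Qed.

Lemma morph_prod (I : Type) (r : seq I) (F : I -> G) :
  f (\prod_(i <- r) F i) = \prod_(i <- r) f (F i).
Proof. by elim: r => [|i r IH]; rewrite ?big_nil ?morph1 // !big_cons fM IH. Qed.

End Morphisms.

Section SubgroupTheory.
Variable G : groupType.
Implicit Types (H S : set G).

Lemma subgroupX H x n : subgroup H -> H x -> H (x ^+ n).
Proof.
by move=> [H1 HM _] Hx; elim: n => // n IH; rewrite expgS; apply: HM.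
Qed.

Lemma subgroupZ H x n : subgroup H -> H x -> H (zpow x n).
Proof.
move=> sgH Hx; have [_ _ HV] := sgH.
by case: n => n /=; [|apply: HV]; exact: subgroupX.
Qed.

Lemma generated_subgroup S : subgroup (generated S).
Proof.
split.
- by move=> N [[]].
- by move=> x y Sx Sy N SN; have [[_ NM _] _] := SN;
     apply: NM; [exact: Sx | exact: Sy].
- by move=> x Sx N SN; have [[_ _ NV] _] := SN; apply: NV; exact: Sx.
Qed.

Lemma generated_sub S : S `<=` generated S.
Proof. exact: sub_gen_smallest. Qed.

Lemma generated_min S H : subgroup H -> S `<=` H -> generated S `<=` H.
Proof. exact: smallest_sub. Qed.

Lemma finitely_generatedP H :
  finitely_generated H <-> exists s : seq G, generated [set` s] = H.
Proof.
split=> [[S /finite_seqP[s ->] SH]|[s sH]]; first by exists s.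
by exists [set` s] => //; exact: finite_seq.
Qed.

End SubgroupTheory.

Section SubgroupMorphisms.
Variables (G G' : groupType) (f : G -> G').
Hypothesis fM : {morph f : x y / x * y}.

Lemma subgroup_preim (H : set G') :
  subgroup H -> subgroup [set x | H (f x)].
Proof.
move=> [H1 HM HV]; split=> [|x y Hx Hy|x Hx] /=.
- by rewrite (morph1 fM).
- by rewrite fM; apply: HM.
- by rewrite (morphV fM); apply: HV.
Qed.

Lemma subgroup_image (H : set G) : subgroup H -> subgroup (f @` H).
Proof.
move=> [H1 HM HV]; split=> [|_ _ [x Hx <-] [y Hy <-]|_ [x Hx <-]] /=.
- by exists 1 => //; exact: morph1.
- by exists (x * y); [exact: HM|].
- by exists x^-1; [exact: HV|exact: morphV].
Qed.

Lemma generated_image (S : set G) : f @` generated S = generated (f @` S).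
Proof.
apply/seteqP; split.
  move=> _ [x Sx <-].
  suff: generated S `<=` [set y | generated (f @` S) (f y)] by apply.
  apply: generated_min; first exact: (subgroup_preim (generated_subgroup _)).
  by move=> y Sy; apply: generated_sub; exists y.
apply: generated_min; first exact: (subgroup_image (generated_subgroup _)).
by move=> _ [x Sx <-]; exists x => //; exact: generated_sub.
Qed.

End SubgroupMorphisms.

Section FreeGroupTheory.
Variables (X : choiceType) (G : groupType) (e : X -> G).

Let letter (p : X * bool) : G := if p.2 then (e p.1)^-1 else e p.1.
Let eval (w : word X) : G := \prod_(p <- w) letter p.

Let eval_word_eq u v : word_eq u v -> eval u = eval v.
Proof.
elim=> {u v} [//|u v _ -> //|u v w _ -> _ -> //|u v x b].
rewrite /eval !big_cat /= !big_cons; congr (_ * _).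
by rewrite mulgA /letter; case: b => /=; rewrite ?mulVg ?mulgV mul1g.
Qed.

Definition free_lift (p : free_group X) : G := eval (repr p).

Lemma free_liftM : {morph free_lift : p q / p * q}.
Proof.
move=> p q; rewrite /free_lift -[RHS]big_cat; apply: eval_word_eq.
exact: repr_pi_eq.
Qed.

Lemma free_lift_gen x : free_lift (free_gen x) = e x.
Proof.
rewrite /free_lift; transitivity (eval [:: (x, false)]).
  by apply: eval_word_eq; exact: repr_pi_eq.
by rewrite /eval big_seq1.
Qed.

End FreeGroupTheory.

Section FreeGroupGeneration.
Variable X : choiceType.

Lemma free_group_ind (H : set (free_group X)) :
  subgroup H -> (forall x, H (free_gen x)) -> forall p, H p.
Proof.
move=> [H1 HM HV] Hgen; elim/free_ind.
elim=> [|[x b] u IH]; first exact: H1.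
have -> : \pi_(free_group X) ((x, b) :: u) =
          \pi_(free_group X) [:: (x, b)] * \pi_(free_group X) u.
  by rewrite -[RHS]/(free_mul _ _) free_mulE.
apply: HM => //; case: b; last exact: Hgen.
have -> : \pi_(free_group X) [:: (x, true)] = (free_gen x)^-1.
  by rewrite -[RHS]/(free_inv _) /free_gen free_invE.
exact: HV.
Qed.

Lemma free_morph_eq (G : groupType) (f h : free_group X -> G) :
  {morph f : x y / x * y} -> {morph h : x y / x * y} ->
  (forall x, f (free_gen x) = h (free_gen x)) -> f =1 h.
Proof.
move=> fM hM fh; apply: free_group_ind => //; split=> [|x y|x] /=.
- by rewrite !morph1.
- by rewrite fM hM => -> ->.
- by rewrite (morphV fM) (morphV hM) => ->.
Qed.

End FreeGroupGeneration.

Section QuotientTheory.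
Variables (G : groupType) (S : set G).

Lemma projM : {morph proj S : x y / x * y}.
Proof. by move=> x y; rewrite -[RHS]/(quot_mul _ _) quot_mulE. Qed.

Lemma proj_surj (q : quot S) : exists x, proj S x = q.
Proof. by exists (repr q); rewrite /proj reprK. Qed.

Lemma proj_rel x : S x -> proj S x = 1.
Proof.
move=> Sx; rewrite -(morph1 projM); apply/esym/projP.
by rewrite invg1 mul1g; exact: sub_gen_smallest.
Qed.

Lemma quot_lift (G' : groupType) (f : G -> G') :
  {morph f : x y / x * y} -> (forall x, S x -> f x = 1) ->
  exists2 h : quot S -> G',
    {morph h : x y / x * y} & forall x, h (proj S x) = f x.
Proof.
move=> fM fS.
have fN x : normal_closure S x -> f x = 1.
  apply: (@smallest_sub _ _ S [set x | f x = 1]) => //; split; first split.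
  - exact: morph1.
  - by move=> a b /= fa fb; rewrite fM fa fb mul1g.
  - by move=> a /= fa; rewrite morphV // fa invg1.
  - by move=> a b /= fa; rewrite /conjg !fM fa mul1g morphV // mulVg.
have fE x : f (repr (proj S x)) = f x.
  apply/esym/eqP; rewrite -divg_eq1 -invg_eq1 invgF; apply/eqP.
  have /fN := @repr_proj G S x; rewrite fM morphV // => /mulg1_eq.
  by rewrite invgK => ->; rewrite mulgV.
exists (fun q => f (repr q)) => // x y.
by have := fE (repr x * repr y); rewrite fM => <-.
Qed.

End QuotientTheory.

Section IntegerPowerTheory.
Variable G : groupType.
Implicit Type x : G.

Lemma zpow0 x : zpow x 0 = 1. Proof. by []. Qed.
Lemma zpow1 x : zpow x 1 = x. Proof. by []. Qed.

Lemma zpowN x n : zpow x (- n)%R = (zpow x n)^-1.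
Proof. by apply: (mulIg (zpow x n)); rewrite -zpowD addNr mulVg. Qed.

Lemma zpow_conj x y n : zpow (y * x * y^-1) n = y * zpow x n * y^-1.
Proof.
have jM : {morph (fun a => y * a * y^-1) : a b / a * b}.
  by move=> a b; rewrite !mulgA mulgVK.
by rewrite (morph_zpow jM x n).
Qed.

End IntegerPowerTheory.

(** * Subgroups of finite index *)

Section FiniteIndex.
Variable G : groupType.
Implicit Type H : set G.

Lemma finite_index_of (T : finType) (cls : G -> T) H :
  subgroup H -> (forall x y, cls x = cls y -> H (x * y^-1)) -> finite_index H.
Proof.
move=> [H1 HM HV] clsH; pose coset x := [set x * h | h in H].
pose rep (t : T) := xget 1 [set x | cls x^-1 = t].
apply: (@sub_finite_set _ _ ((coset \o rep) @` [set: T])); last first.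
  exact: finite_image finite_finset.
move=> _ [x _ <-]; exists (cls x^-1) => //=.
have /(_ x erefl)/= /clsH : forall y, cls y^-1 = cls x^-1 ->
    cls (rep (cls x^-1))^-1 = cls x^-1.
  by move=> y ?; rewrite /rep; case: xgetP => // /(_ y).
rewrite invgK => Hrx; apply/seteqP; split=> _ [h Hh <-].
- exists (x^-1 * rep (cls x^-1) * h); last by rewrite !mulgA mulgV mul1g.
  by apply: HM => //; have := HV _ Hrx; rewrite invgM invgK.
- exists ((rep (cls x^-1))^-1 * x * h); first exact: HM.
  by rewrite !mulgA mulgV mul1g.
Qed.

(** A subgroup of finite index has finitely many right cosets as well:
    inversion exchanges the two kinds of cosets. *)
Lemma finite_indexP H :
  subgroup H -> finite_index H ->
  exists n (cls : G -> 'I_n) (rep : 'I_n -> G),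
    cancel rep cls /\ forall x y, cls x = cls y <-> H (x * y^-1).
Proof.
move=> [H1 HM HV] /finite_seqP[s sE].
pose coset x := [set x * h | h in H].
have cosetE x y : coset x = coset y <-> H (x^-1 * y).
  split=> [xy|Hxy].
    have : coset x y by rewrite xy; exists 1; rewrite // mulg1.
    by case=> h Hh <-; rewrite mulKg.
  apply/seteqP; split=> _ [h Hh <-].
  - exists (y^-1 * x * h); last by rewrite !mulgA mulgV mul1g.
    by apply: HM => //; have := HV _ Hxy; rewrite invgM invgK.
  - by exists (x^-1 * y * h); [exact: HM | rewrite !mulgA mulgV mul1g].
have s_coset x : coset x \in s.
  by have : [set` s] (coset x) by rewrite -sE; exists x.
pose t := undup s.
have t_coset x : (index (coset x) t < size t)%N.
  by rewrite index_mem mem_undup.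
pose cls x := Ordinal (t_coset x^-1).
pose rep (i : 'I_(size t)) := (xget 1 [set x | coset x = nth set0 t i])^-1.
exists (size t), cls, rep; split=> [i|x y].
  apply/val_inj => /=; rewrite invgK.
  have : [set` s] (nth set0 t i) by rewrite /= -mem_undup mem_nth.
  rewrite -sE => -[x _ xE]; case: xgetP => [_ _ ->|/(_ x)//].
  by rewrite index_uniq // undup_uniq.
split=> [[]/(congr1 (nth set0 t))|Hxy].
  rewrite !nth_index ?mem_undup // => /cosetE.
  by rewrite invgK.
by apply: val_inj => /=; congr (index _ _); apply/cosetE; rewrite invgK.
Qed.

Lemma finite_index_power H x :
  subgroup H -> finite_index H -> exists2 n, (0 < n)%N & H (x ^+ n).
Proof.
move=> sgH /(finite_indexP sgH)[n [cls [_ [_ clsE]]]].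
have /injectivePn[i [j neq_ij]] : ~~ injectiveb (fun i : 'I_n.+1 => cls (x ^+ i)).
  by apply/injectiveP => /leq_card; rewrite !card_ord ltnn.
wlog lt_ij : i j neq_ij / (j < i)%N.
  move=> IH; case: (ltngtP i j) => [|/IH|/val_inj/eqP]; last by rewrite (negPf neq_ij).
    by rewrite eq_sym in neq_ij => /IH + /esym; apply.
  by move=> + e; apply.
move=> /clsE Hij; exists (i - j)%N; first by rewrite subn_gt0.
by rewrite expgnFr // ltnW.
Qed.

(** Schreier: rewriting a word in the generators from left to right, and
    replacing each prefix by its coset representative, writes an element of H
    as a product of the finitely many elements below. *)
Lemma finite_index_fg H :
  finitely_generated [set: G] -> subgroup H -> finite_index H ->
  finitely_generated H.
Proof.
move=> [S finS SG] sgH /(finite_indexP sgH)[n [cls [rep [repK clsE]]]].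
have [H1 HM HV] := sgH.
pose h i x := rep i * x * (rep (cls (rep i * x)))^-1.
have clsM x y z : cls x = cls y -> cls (x * z) = cls (y * z).
  by move=> /clsE xy; apply/clsE; rewrite invgM !mulgA mulgK.
have Hh i x : H (h i x) by apply/clsE; rewrite repK.
have H1r : H (rep (cls 1)) by have := HV _ (Hh (cls 1) (rep (cls 1))^-1);
  rewrite /h mulgV mul1g invgK.
pose U := [set h t.1 t.2 | t in [set: 'I_n] `*` S] `|` [set rep (cls 1)].
exists U.
  rewrite finite_setU; split; last exact: finite_set1.
  by apply: finite_image; apply: finite_setX => //; exact: finite_finset.
apply/seteqP; split.
  by apply: generated_min => // x [[[i y] _ <-]|->].
have [U1 UM UV] := generated_subgroup U.
have UT x : forall i, generated U (h i x).
  have : generated S x by rewrite SG.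
  suff: generated S `<=` [set x | forall i, generated U (h i x)] by apply.
  apply: generated_min; last first.
    by move=> y Sy i; apply: generated_sub; left; exists (i, y).
  split=> [i|y z Uy Uz i|y Uy i] /=.
  - by rewrite /h mulg1 repK mulgV.
  - set j := cls (rep i * y).
    have := UM _ _ (Uy i) (Uz j); rewrite /h -/j !mulgA mulgVK.
    by congr (generated U (_ * (rep _)^-1)); apply: clsM; rewrite repK.
  - set j := cls (rep i * y^-1).
    have := UV _ (Uy j); rewrite /h -/j !invgM invgK !mulgA.
    suff -> : cls (rep j * y) = i by [].
    by rewrite -[RHS]repK -[in RHS](mulgVK y (rep i)); apply: clsM; rewrite repK.
move=> x Hx; set r := rep (cls 1).
have Ur : generated U r by apply: generated_sub; right.
have rx : cls (rep (cls 1) * x) = cls 1.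
  by apply/clsE; rewrite invg1 mulg1; exact: HM.
have := UM _ _ (UV _ Ur) (UM _ _ (UT x (cls 1)) Ur).
by rewrite /h rx -/r mulgVK mulKg.
Qed.

End FiniteIndex.

Lemma finite_index_preim (G G' : groupType) (f : G' -> G) (H : set G) :
  {morph f : x y / x * y} -> subgroup H -> finite_index H ->
  finite_index [set x | H (f x)].
Proof.
move=> fM sgH /(finite_indexP sgH)[n [cls [_ [_ clsE]]]].
apply: (@finite_index_of _ _ (cls \o f)) => [|x y /clsE].
  exact: (subgroup_preim fM sgH).
by rewrite /= fM (morphV fM).
Qed.

(** * Characteristic subgroups *)

(** In a finitely generated group G, a subgroup of index n contains the common
    kernel of all the homomorphisms from G to the symmetric group of degree n.
    There are finitely many of them, so this characteristic subgroup has finite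
    index. *)
Lemma characteristic_core (G : groupType) (H : set G) :
  finitely_generated [set: G] -> subgroup H -> finite_index H ->
  exists H' : set G,
    [/\ subgroup H', finite_index H', characteristic H' & H' `<=` H].
Proof.
move=> /finitely_generatedP[s sG] sgH /(finite_indexP sgH)[n [cls [rep [repK clsE]]]].
pose hom (f : G -> 'S_n) := {morph f : x y / x * y}.
pose H' := [set x | forall f, hom f -> f x = 1].
have sgH' : subgroup H'.
  split=> [f fM|x y Hx Hy f fM|x Hx f fM].
  - exact: morph1.
  - by rewrite fM Hx // Hy // mul1g.
  - by rewrite (morphV fM) Hx // invg1.
have homJ (f : G -> 'S_n) (a : aut G) : hom f -> hom (f \o a).
  by move=> fM x y; rewrite /= autM fM.
exists H'; split=> //.
- (* A homomorphism is determined by its values on the generators s, so the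
     values at x of all homomorphisms form an element of a finite type. *)
  pose I := 'I_(size s).
  pose ext (d : {ffun I -> 'S_n}) : G -> 'S_n :=
    xget (fun=> 1) [set f | hom f /\ forall i : I, f s`_i = d i].
  have extM d : hom (ext d).
    rewrite /ext; case: xgetP => [f _ []//|_ x y].
    by rewrite mulg1.
  apply: (@finite_index_of _ _ (fun x => [ffun d => ext d x])) => // x y xy f fM.
  pose d := [ffun i : I => f s`_i].
  have fd : f =1 ext d.
    have [eM ed] : hom (ext d) /\ forall i : I, ext d s`_i = d i.
      by rewrite /ext; case: xgetP => [//|/(_ f)[]]; split=> // i; rewrite ffunE.
    have : generated [set` s] `<=` [set z | f z = ext d z].
      apply: generated_min.
        split=> /= [|a b fa fb|a fa]; first by rewrite !morph1.
          by rewrite fM eM fa fb.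
        by rewrite (morphV fM) (morphV eM) fa.
      move=> z /= zs; have zi : (index z s < size s)%N by rewrite index_mem.
      by have := ed (Ordinal zi); rewrite ffunE /= nth_index.
    by rewrite sG => fE z; exact: fE.
  have : ext d x = ext d y by have := congr1 (fun h : {ffun _ -> _} => h d) xy; rewrite !ffunE.
  by rewrite -!fd => fxy; rewrite fM (morphV fM) fxy mulgV.
- move=> a; apply/seteqP; split=> [_ [x Hx <-] f fM|x Hx].
    by rewrite -[f _]/((f \o a) x) Hx //; exact: homJ.
  exists (aut_bwd a x); last exact: autVK.
  by move=> f fM; rewrite -[f _]/((f \o aut_inv a) x) Hx //; exact: homJ.
- move=> x Hx.
  have clsM y z u : cls y = cls z -> cls (y * u) = cls (z * u).
    by move=> /clsE yz; apply/clsE; rewrite invgM !mulgA mulgK.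
  have actK u : cancel (fun i => cls (rep i * u)) (fun i => cls (rep i * u^-1)).
    move=> i; rewrite -[RHS]repK -[in RHS](mulgK u (rep i)).
    by apply: clsM; rewrite repK.
  pose f u : 'S_n := perm (can_inj (actK u)).
  have fM : hom f.
    move=> u v; apply/permP=> i; rewrite permM !permE mulgA.
    by apply: clsM; rewrite repK.
  have /permP/(_ (cls 1)) := Hx f fM; rewrite permE perm1.
  have -> : cls (rep (cls 1) * x) = cls (1 * x) by apply: clsM; rewrite repK.
  by move=> /clsE; rewrite mul1g invg1 mulg1.
Qed.

(** * Potentials on the Cayley graph of a free group *)

Section Potential.
Variables (X : choiceType) (V : zmodType).
Variable d : X -> free_group X -> V.

(* The increment of the potential along the edge from x that the letter p
   labels. *)
Let step (x : free_group X) (p : X * bool) : V :=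
  if p.2 then (- d p.1 (x * (free_gen p.1)^-1)%g)%R else d p.1 x.
Let letter (p : X * bool) : free_group X :=
  if p.2 then (free_gen p.1)^-1 else free_gen p.1.
Let move (t : free_group X * V) (p : X * bool) :=
  (t.1 * letter p, (t.2 + step t.1 p)%R).
Let run := foldl move.

Let move_cancel t x b : move (move t (x, b)) (x, ~~ b) = t.
Proof.
case: t => p v; rewrite /move /letter /step /=.
by case: b => /=; rewrite ?mulgVK ?mulgK -addrA ?addNr ?subrr addr0.
Qed.

Let run_word_eq u v : word_eq u v -> forall t, run t u = run t v.
Proof.
elim=> {u v} [//|u v _ IH t|u v w _ IH1 _ IH2 t|u v x b t].
- by rewrite IH.
- by rewrite IH1.
- by rewrite /run !foldl_cat /= move_cancel.
Qed.

Let run1 w : forall t, (run t w).1 = t.1 * \pi_(free_group X) w.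
Proof.
elim: w => [|p w IH] t /=; first by rewrite -[\pi__ _]/(1 : free_group X) mulg1.
rewrite IH /= -mulgA; congr (_ * _).
have -> : \pi_(free_group X) (p :: w) =
          \pi_(free_group X) [:: p] * \pi_(free_group X) w.
  by rewrite -[RHS]/(free_mul _ _) free_mulE.
congr (_ * _); rewrite /letter; case: p => x [] //=.
by rewrite -[LHS]/(free_inv _) /free_gen free_invE.
Qed.

(** The Cayley graph of a free group is a tree, so every function on its edges
    is the difference of a function on its vertices. *)
Lemma free_potential :
  exists B : free_group X -> V,
    B 1 = 0%R /\ forall p x, B (p * free_gen x) = (B p + d x p)%R.
Proof.
exists (fun p => (run (1, 0%R) (repr p)).2); split.
  by rewrite (run_word_eq (repr_pi_eq [::])).
move=> p x; have pE : word_eq (repr (p * free_gen x)) (repr p ++ [:: (x, false)]).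
  apply/free_piP; rewrite reprK -free_mulE reprK.
  by rewrite -[LHS]/(free_mul _ _).
by rewrite (run_word_eq pE) /run foldl_cat /= -/run /step /= run1 mul1g reprK.
Qed.

End Potential.

(** The generators connect the Cayley graph, so the increments along its edges
    determine those between any two vertices. *)
Lemma potential_unique (X : choiceType) (V : zmodType) (B B' : free_group X -> V) :
  (forall p x, (B (p * free_gen x)%g - B p = B' (p * free_gen x)%g - B' p)%R) ->
  forall p q, (B q - B p = B' q - B' p)%R.
Proof.
move=> BB'; have inc q : forall p, (B (p * q)%g - B p = B' (p * q)%g - B' p)%R.
  apply: (free_group_ind (H := fun q => forall p, (B (p * q)%g - B p = B' (p * q)%g - B' p)%R)).
    split=> [p|a b Ha Hb p|a Ha p].
    - by rewrite mulg1 !subrr.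
    - by rewrite mulgA -(subrKA (B (p * a)%g)) Hb Ha subrKA.
    - by have := Ha (p * a^-1); rewrite mulgVK -opprB => /(canRL opprK) ->; rewrite opprB.
  by move=> x p; exact: BB'.
by move=> p q; have := inc (p^-1 * q) p; rewrite mulVKg.
Qed.

Definition potential (X : choiceType) (V : zmodType) (d : X -> free_group X -> V) :
    free_group X -> V := sval (cid (free_potential d)).

Section PotentialTheory.
Variables (X : choiceType) (V : zmodType).
Implicit Types (d : X -> free_group X -> V) (B : free_group X -> V).

Lemma potential1 d : potential d 1 = 0%R.
Proof. by rewrite /potential; case: cid => B []. Qed.

Lemma potentialS d p x : potential d (p * free_gen x) = (potential d p + d x p)%R.
Proof. by rewrite /potential; case: cid => B []. Qed.

Lemma potentialSV d p x :
  potential d (p * (free_gen x)^-1) = (potential d p - d x (p * (free_gen x)^-1)%g)%R.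
Proof.
by rewrite -[in potential d p](mulgVK (free_gen x) p) potentialS addrK.
Qed.

Lemma potentialE d B :
  B 1 = 0%R -> (forall p x, B (p * free_gen x) = (B p + d x p)%R) -> B =1 potential d.
Proof.
move=> B1 BS p; have := @potential_unique _ _ B (potential d) _ 1 p.
rewrite B1 potential1 !subr0; apply=> q x.
by rewrite BS potentialS addrC addKr addrC addKr.
Qed.

End PotentialTheory.

(** The translate of the potential by h has the same increments, hence differs
    from it by a constant.  On a subgroup of such h, the potential is therefore a
    homomorphism. *)
Lemma potential_translate (X : choiceType) (V : zmodType) (B : free_group X -> V) h :
  B 1 = 0%R ->
  (forall p x, (B (h * p * free_gen x)%g - B (h * p)%g =
                B (p * free_gen x)%g - B p)%R) ->
  forall p, B (h * p) = (B h + B p)%R.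
Proof.
move=> B1 Bh p; have := @potential_unique _ _ (fun p => B (h * p)) B _ 1 p.
rewrite mulg1 B1 subr0 => <- => [|q x]; first by rewrite subrKC.
by rewrite mulgA Bh.
Qed.

(** * Finite index subgroups of free groups do not fiber *)

Section FreeNotFibering.
Variables (X : finType) (H : set (free_group X)).
Hypotheses (sgH : subgroup H) (fiH : finite_index H).

(** Let f : H -> Z be onto, with a kernel generated by d elements.  The subgroup
    of H where f is divisible by N is generated by d + 1 elements, and its index
    is a multiple of N.  The potential of a mod 2 function on the edges of its
    finite coset graph restricts to a homomorphism on it, and is determined by
    d + 1 values of this homomorphism and by one value over each vertex.  Since
    there are at least twice as many edges as vertices, the graph has at most
    d + 1 vertices, which is false when N > d + 1. *)
Lemma free_not_fibering : (1 < #|X|)%N -> ~ algebraically_fibers H.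
Proof.
move=> cardX [f [fM f_surj /finitely_generatedP[s sE]]].
have [H1 HM HV] := sgH.
have [n [cls [rep [repK clsE]]]] := finite_indexP sgH fiH.
have [t Ht ft] := f_surj 1%R.
have f1 : f 1 = 0%R by apply: (addrI (f 1)); rewrite -fM // mulg1 addr0.
have fV x : H x -> f x^-1 = (- f x)%R.
  move=> Hx; apply/eqP; rewrite -addr_eq0 -fM ?mulVg ?f1 //; exact: HV.
have ftX (k : nat) : f (t ^+ k) = Posz k.
  elim: k => [|k IH]; first by rewrite f1.
  by rewrite expgS fM ?ft ?IH //; exact: subgroupX.
pose N := (size s).+2; pose Y := ('I_n * 'I_N)%type.
pose HN := [set x | H x /\ (Posz N %| f x)%Z].
have sgHN : subgroup HN.
  split=> [|x y [Hx fx] [Hy fy]|x [Hx fx]].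
  - by split; rewrite // f1 dvdz0.
  - by split; [exact: HM | rewrite fM // rpredD].
  - by split; [exact: HV | rewrite fV // rpredN].
pose part x := x * (rep (cls x))^-1.
have Hpart x : H (part x) by apply/clsE; rewrite repK.
have residue_lt (a : int) : (`|(a %% Posz N)%Z| < N)%N.
  by rewrite -ltz_nat gez0_abs ?modz_ge0 // ltz_pmod.
pose res (a : int) := Ordinal (residue_lt a).
have resE (a b : int) : (Posz N %| (a - b)%R)%Z -> res a = res b.
  by rewrite -eqz_mod_dvd => /eqP ab; apply: val_inj; rewrite /= ab.
pose col x : Y := (cls x, res (f (part x))).
pose rept (y : Y) := t ^+ y.2 * rep y.1.
have clsM h x : H h -> cls (h * x) = cls x.
  by move=> Hh; apply/clsE; rewrite mulgK.
have HtX k : H (t ^+ k) by exact: subgroupX.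
have reptK : cancel rept col.
  case=> i j; rewrite /rept /col /part /= clsM // repK mulgK ftX.
  by congr pair; apply: val_inj; rewrite /= modz_nat absz_nat modn_small.
have colM h x : HN h -> col (h * x) = col x.
  move=> [Hh Nh]; rewrite /col clsM //; congr pair; apply: resE.
  have -> : part (h * x) = h * part x by rewrite /part clsM // mulgA.
  by rewrite fM // addrK.
have HNrept x : HN (x * (rept (col x))^-1).
  rewrite /rept /= invgM mulgA -/(part x); split; first by apply: HM => //; exact: HV.
  rewrite fM // ?fV // ?ftX /=; last exact: HV.
  rewrite gez0_abs ?modz_ge0 // -eqz_mod_dvd modz_mod; exact: eqxx.
have HN_gen : HN `<=` generated [set` rcons s (t ^+ N)].
  move=> x [Hx /dvdzP[k fx]]; set U := [set` _].
  have [_ UM UV] := generated_subgroup U.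
  have Ut : generated U (zpow (t ^+ N) k).
    apply: (subgroupZ k (generated_subgroup U)).
    by apply: generated_sub; rewrite /U /= mem_rcons mem_head.
  rewrite -(mulgVK (zpow (t ^+ N) k) x); apply: UM => //.
  have HtNk : H (zpow (t ^+ N) k) by exact: subgroupZ.
  have fz k' : f (zpow (t ^+ N) k') = (k' * Posz N)%R.
    elim/int_ind: k' => [|m IH|m IH].
    - by rewrite f1 mul0r.
    - by rewrite -addn1 PoszD zpowS fM ?IH ?ftX ?mulrDl ?mul1r //; exact: subgroupZ.
    - apply: (addIr (Posz N)); rewrite -{1}(ftX N) -fM //; last exact: subgroupZ.
      rewrite -zpowS -addn1 PoszD opprD addrNK IH mulrDl -addrA mulN1r addNr addr0 //.
  have : [set x | H x /\ f x = 0%R] (x * (zpow (t ^+ N) k)^-1).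
    by split; [apply: HM => //; exact: HV | rewrite fM // ?fV // ?fz ?fx ?subrr //; exact: HV].
  rewrite -sE; apply: (generated_min (generated_subgroup U)).
  by move=> y ys; apply: generated_sub; rewrite /U /= mem_rcons inE ys orbT.
(* The potential of a function on the edges of the coset graph. *)
pose pot (e : {ffun X * Y -> 'I_2}) :=
  potential (fun x p => e (x, col p)).
have pot1 e : pot e 1 = 0%R by exact: potential1.
have potS e p x : pot e (p * free_gen x) = (pot e p + e (x, col p))%R.
  exact: potentialS.
have potM e h p : HN h -> pot e (h * p) = (pot e h + pot e p)%R.
  move=> Hh; apply: potential_translate => // q x.
  by rewrite !potS addrC addKr addrC addKr colM.
pose Psi e : {ffun 'I_(size s).+1 -> 'I_2} * {ffun Y -> 'I_2} :=
  ([ffun i : 'I_(size s).+1 => pot e (nth 1 (rcons s (t ^+ N)) i)], [ffun y => pot e (rept y)]).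
have Psi_inj : injective Psi.
  move=> e e' [/ffunP ee1 /ffunP ee2].
  have potN x : HN x -> pot e x = pot e' x.
    suff : generated [set` rcons s (t ^+ N)] `<=`
           [set x | HN x /\ pot e x = pot e' x] by move=> sub /HN_gen /sub[].
    have [HN1 HNM HNV] := sgHN.
    apply: generated_min.
      split=> [|x1 y [Hx ex] [Hy ey]|x1 [Hx ex]].
      - by split; rewrite // !pot1.
      - by split; [exact: HNM | rewrite !potM // ex ey].
      - split; first exact: HNV.
        by apply: (addrI (pot e x1)); rewrite -potM // ex -potM // !mulgV !pot1.
    move=> z /= zs; split.
      move: zs; rewrite mem_rcons inE => /orP[/eqP ->|zs].
        by split; [exact: HtX | rewrite ftX dvdzz].
      have : generated [set` s] z by exact: generated_sub.
      by rewrite sE => -[Hz fz]; split; rewrite // fz dvdz0.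
    have zi : (index z (rcons s (t ^+ N)) < (size s).+1)%N.
      by rewrite -(size_rcons s (t ^+ N)) index_mem.
    by have := ee1 (Ordinal zi); rewrite !ffunE /= nth_index.
  have potE x : pot e x = pot e' x.
    have Nx := HNrept x; rewrite -(mulgVK (rept (col x)) x); move: Nx.
    set h := (x / _); move=> Nh; rewrite (potM e _ _ Nh) (potM e' _ _ Nh) (potN _ Nh).
    congr (_ + _)%R; by have := ee2 (col x); rewrite !ffunE.
  apply/ffunP=> -[x y]; rewrite -(reptK y).
  by apply: (addrI (pot e (rept y))); rewrite -potS potE potS potE.
have := leq_card Psi Psi_inj.
rewrite card_prod !card_ffun card_prod !card_ord -expnD leq_exp2l //.
have n_gt0 : (0 < n)%N by apply: leq_ltn_trans (ltn_ord (cls 1)).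
rewrite card_prod !card_ord => le1.
have : (2 * (n * N) <= (size s).+1 + n * N)%N.
  by apply: leq_trans le1; rewrite leq_mul2r cardX orbT.
rewrite mul2n -addnn leq_add2r leqNgt => /negP; apply.
by rewrite -[(size s).+2]mul1n leq_mul2r n_gt0 orbT.
Qed.

End FreeNotFibering.

(** * Chains, cochains and their pairing *)

Section FreeModuleLift.
Variables (R : nzRingType) (M : lmodType R) (T : choiceType) (f : T -> M).
Local Open Scope ring_scope.

Lemma fglift0 : fglift f 0 = 0.
Proof. by rewrite -(subrr 0) lift_is_additive subrr. Qed.

Lemma fgliftB : {morph fglift f : a b / a - b}.
Proof. exact: lift_is_additive. Qed.

Lemma fgliftN : {morph fglift f : a / - a}.
Proof. by move=> a; rewrite -sub0r fgliftB fglift0 sub0r. Qed.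

Lemma fgliftD : {morph fglift f : a b / a + b}.
Proof. by move=> a b; rewrite -{1}(opprK b) fgliftB fgliftN opprK. Qed.

Lemma fglift_sum I (r : seq I) (F : I -> {freeg T / R}) :
  fglift f (\sum_(i <- r) F i) = \sum_(i <- r) fglift f (F i).
Proof.
by elim: r => [|i r IH]; rewrite ?big_nil ?fglift0 // !big_cons fgliftD IH.
Qed.

Lemma fgliftU x : fglift f << x >> = f x.
Proof. by rewrite liftU scale1r. Qed.

Lemma fglift_dom a : fglift f a = \sum_(x <- dom a) coeff x a *: f x.
Proof.
rewrite -{1}(freeg_sumE a) fglift_sum; apply: eq_bigr => x _; exact: liftU.
Qed.

Lemma fgliftZ k a : fglift f (k *: a) = k *: fglift f a.
Proof.
elim/freeg_ind_dom0: a => [|k' x a _ _ IH]; first by rewrite scaler0 fglift0 scaler0.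
have -> : k *: (<< k' *g x >> + a) = << k * k' *g x >> + k *: a.
  by rewrite scalerDr; congr (_ + _); apply/eqP/freeg_eqP=> y; rewrite coeffZ !coeffU mulrA.
by rewrite !fgliftD IH scalerDr !liftU scalerA.
Qed.

End FreeModuleLift.

Lemma fglift_comp (R : nzRingType) (M : lmodType R) (T U : choiceType)
    (f : U -> M) (F : T -> {freeg U / R}) a :
  fglift f (fglift F a) = fglift (fun x => fglift f (F x)) a.
Proof.
rewrite (fglift_dom F) [RHS]fglift_dom fglift_sum.
by apply: eq_bigr => x _; rewrite fgliftZ.
Qed.

Section IntegralPairing.
Variable T : choiceType.
Local Open Scope ring_scope.

(** The fundamental class is integral while cochains are rational, so the pairing
    views the rationals as a module over the integers. *)
Definition pairing (c : T -> rat) (a : {freeg T / int}) : rat :=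
  fglift (c : T -> zmodule rat) a.

Lemma pairingU c x : pairing c << x >> = c x.
Proof. by rewrite /pairing fgliftU. Qed.

Lemma pairing0 c : pairing c 0 = 0.
Proof. by rewrite /pairing fglift0. Qed.

Lemma pairingB c : {morph pairing c : a b / a - b}.
Proof. by move=> a b; rewrite /pairing fgliftB. Qed.

Lemma pairingD c : {morph pairing c : a b / a + b}.
Proof. by move=> a b; rewrite /pairing fgliftD. Qed.

Lemma pairing_sum c I (r : seq I) (F : I -> {freeg T / int}) :
  pairing c (\sum_(i <- r) F i) = \sum_(i <- r) pairing c (F i).
Proof. by rewrite /pairing fglift_sum. Qed.

Lemma pairing_lin k (c c' : T -> rat) a :
  pairing (fun x => k * c x + c' x) a = k * pairing c a + pairing c' a.
Proof.
rewrite /pairing !fglift_dom mulr_sumr -big_split; apply: eq_bigr => x _ /=.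
by rewrite !scalezrE mulrzDl mulrzAr.
Qed.

End IntegralPairing.

Section BarPairing.
Variable G : groupType.
Implicit Types (c : G * G -> rat) (u : G -> rat).

Definition cobound u : G * G -> rat :=
  fun p => (u p.2 - u (p.1 * p.2)%g + u p.1)%R.

Definition cocycle c := forall x y z,
  (c (y, z) - c ((x * y)%g, z) + c (x, (y * z)%g) - c (x, y) = 0)%R.

Lemma pairing_cobound u z : pairing (cobound u) z = pairing u (bar_d2 z).
Proof.
rewrite {2}/pairing /bar_d2 fglift_comp.
have -> : cobound u = fun p => pairing u (<< p.2 >> - << (p.1 * p.2)%g >> + << p.1 >>)%R.
  by apply/funext => p; rewrite pairingD pairingB !pairingU.
by [].
Qed.

Lemma pairing_boundary c d : cocycle c -> pairing c (bar_d3 d) = 0%R.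
Proof.
move=> cc; rewrite /pairing /bar_d3 fglift_comp.
rewrite fglift_dom big1 // => -[[x y] z] _.
by rewrite fgliftB fgliftD fgliftB !fgliftU [X in (_ *: X)%R]cc scaler0.
Qed.

Lemma pairing_chain2_map (f : G -> G) c z :
  pairing c (chain2_map f z) = pairing (fun p => c (f p.1, f p.2)) z.
Proof.
rewrite {1}/pairing /chain2_map fglift_comp.
have -> : (fun p => c (f p.1, f p.2)) = fun p => pairing c << (f p.1, f p.2) >>.
  by apply/funext => p; rewrite pairingU.
by [].
Qed.

(** The integral of a cocycle over a cycle depends only on the homology class. *)
Lemma pairing_H2_trivial (f : G -> G) c z :
  cocycle c -> acts_trivially_on_H2 int f -> bar_d2 z = 0%R ->
  pairing (fun p => c (f p.1, f p.2)) z = pairing c z.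
Proof.
move=> cc fH2 /fH2[d fz]; rewrite -(pairing_chain2_map f c z).
apply/eqP; rewrite -subr_eq0; apply/eqP.
by rewrite -pairingB fz; exact: pairing_boundary.
Qed.

End BarPairing.

(** * The fundamental cycle of a product of commutators *)

Section CommutatorCycle.
Variable G : groupType.
Local Open Scope ring_scope.

(** The fan triangulation of a polygon: its apex is joined to the successive
    vertices of the boundary path that starts at x and reads the word w. *)
Fixpoint fan (x : G) (w : seq G) : {freeg (G * G) / int} :=
  if w is y :: w' then << (x, y) >> + fan (x * y)%g w' else 0.

Lemma bar_d2_fan w : forall x,
  bar_d2 (fan x w) = \sum_(y <- w) << y >> - << (x * \prod_(y <- w) y)%g >> + << x >>
  :> {freeg G / int}.
Proof.
elim: w => [|y w IH] x; rewrite /bar_d2 /=.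
  by rewrite fglift0 !big_nil mulg1 sub0r addNr.
rewrite fgliftD fgliftU -/(bar_d2 _) IH !big_cons /= mulgA.
by rewrite addrACA [_ - _ + (_ - _)]addrAC [<< x >> + _]addrC addrA addrNK addrA.
Qed.

Definition commutator_word n (x y : 'I_n -> G) : seq G :=
  flatten [seq [:: x i; y i; (x i)^-1%g; (y i)^-1%g] | i <- index_enum 'I_n].

(** Gluing the edges of the polygon in pairs closes the fan up: each pair is
    capped by the degenerate triangle of an element and its inverse. *)
Definition commutator_cycle n (x y : 'I_n -> G) : {freeg (G * G) / int} :=
  fan 1%g (commutator_word x y)
  - \sum_(i < n) (<< (x i, (x i)^-1%g) >> + << (1%g, 1%g) >>
                + (<< (y i, (y i)^-1%g) >> + << (1%g, 1%g) >>)).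

Lemma prod_commutator_word n (x y : 'I_n -> G) :
  (\prod_(z <- commutator_word x y) z = \prod_(i < n) (x i * y i * (x i)^-1 * (y i)^-1))%g.
Proof.
rewrite /commutator_word; elim: (index_enum 'I_n) => [|i r IH] /=; first by rewrite !big_nil.
by rewrite !big_cons IH !mulgA.
Qed.

Lemma sum_commutator_word (V : zmodType) n (x y : 'I_n -> G) (F : G -> V) :
  \sum_(z <- commutator_word x y) F z =
  \sum_(i < n) (F (x i) + F ((x i)^-1)%g + (F (y i) + F ((y i)^-1)%g)).
Proof.
rewrite /commutator_word; elim: (index_enum 'I_n) => [|i r IH] /=; first by rewrite !big_nil.
rewrite !big_cons IH !addrA; congr (_ + _); rewrite -!addrA; congr (_ + _).
by rewrite addrA [in RHS]addrCA !addrA; congr (_ + _); rewrite addrC.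
Qed.

Lemma commutator_cycleP n (x y : 'I_n -> G) :
  (\prod_(i < n) (x i * y i * (x i)^-1 * (y i)^-1) = 1)%g ->
  bar_d2 (commutator_cycle x y) = 0.
Proof.
move=> xy1; rewrite /bar_d2 fgliftB -/(bar_d2 _) bar_d2_fan.
rewrite prod_commutator_word xy1 mulg1 addrNK sum_commutator_word fglift_sum.
rewrite -sumrB big1 // => i _; rewrite !fgliftD !fgliftU /= !mulgV !mulg1.
have cap z : << z^-1%g >> - << 1%g >> + << z >> + (<< 1%g >> - << 1%g >> + << 1%g >>) =
   << z >> + << z^-1%g >> :> {freeg G / int}.
  by rewrite subrr add0r addrAC addrNK addrC.
by rewrite !cap subrr.
Qed.

End CommutatorCycle.

Section CommutatorCyclePairing.
Local Open Scope ring_scope.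

(** Over the fan the values of c telescope to phi at the lifted product minus the
    sum of phi over the letters; the caps add that sum back, as they evaluate c
    on the pairs of a letter and its inverse. *)
Lemma pairing_commutator_cycle (F G : groupType) (p : F -> G) (c : G * G -> rat)
    (phi : F -> rat) n (x y : 'I_n -> F) :
  {morph p : a b / (a * b)%g} -> c (1, 1)%g = 0 ->
  (forall a b, phi (a * b)%g = phi a + phi b + c (p a, p b)) ->
  pairing c (commutator_cycle (p \o x) (p \o y)) =
  phi (\prod_(i < n) (x i * y i * (x i)^-1 * (y i)^-1))%g.
Proof.
move=> pM c1 phiM.
have phi1 : phi 1%g = 0.
  by apply: (addrI (phi 1%g)); rewrite addr0 -[in RHS](mulg1 1%g) phiM (morph1 pM) c1 addr0.
have phiV a : phi a + phi (a^-1)%g = - c (p a, (p a)^-1%g).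
  by apply/eqP; rewrite -addr_eq0 -(morphV pM) -phiM mulgV phi1.
have fanE w : forall a, pairing c (fan (p a) [seq p z | z <- w]) =
    phi (a * \prod_(z <- w) z)%g - phi a - \sum_(z <- w) phi z.
  elim: w => [|z w IH] a /=.
    by rewrite pairing0 !big_nil mulg1 subrr subr0.
  rewrite pairingD pairingU -pM IH !big_cons mulgA (phiM a z).
  ring.
have wordE : commutator_word (p \o x) (p \o y) = map p (commutator_word x y).
  rewrite /commutator_word map_flatten -map_comp; congr flatten.
  by apply: eq_map => i /=; rewrite !(morphV pM).
rewrite /commutator_cycle pairingB wordE -(morph1 pM) fanE.
rewrite mul1g prod_commutator_word phi1 subr0 sum_commutator_word pairing_sum.
rewrite -addrA -opprD -big_split [X in _ - X]big1 /= ?subr0 // => i _.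
rewrite !pairingD !pairingU (morph1 pM) c1 !addr0 !phiV /=.
by rewrite addrACA !addNr addr0.
Qed.

End CommutatorCyclePairing.

(** * The intersection form of a finite index subgroup *)

Section Transfer.
Variables (G : groupType) (H : set G) (n : nat).
Variables (cls : G -> 'I_n) (rep : 'I_n -> G).
Hypotheses (sgH : subgroup H) (repK : cancel rep cls).
Hypothesis clsE : forall x y, cls x = cls y <-> H (x * y^-1).
Local Open Scope ring_scope.

Definition hom_on (a : G -> rat) := forall x y, H x -> H y -> a (x * y)%g = a x + a y.

(** The functions A whose coboundary A(xk) - A(x) depends only on k and on the
    coset of x.  They are the 1-cocycles of G with values in the functions on
    the cosets, written without the coefficient module. *)
Definition equivariant (A : G -> rat) := forall h x, H h -> A (h * x)%g = A h + A x.

Definition invariant (F : G -> rat) := forall h x, H h -> F (h * x)%g = F x.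

(** Shapiro: up to a constant, this is an equivariant extension of a
    homomorphism on H. *)
Definition extend (a : G -> rat) : G -> rat := fun x => a (x * (rep (cls x))^-1)%g.

Lemma cls_mull h x : H h -> cls (h * x)%g = cls x.
Proof. by move=> Hh; apply/clsE; rewrite mulgK. Qed.

Lemma part_H x : H (x * (rep (cls x))^-1)%g.
Proof. by apply/clsE; rewrite repK. Qed.

Lemma hom_on1 a : hom_on a -> a 1%g = 0.
Proof.
by have [H1 _ _] := sgH; move=> /(_ 1 1 H1 H1)%g; rewrite mulg1 => /eqP;
  rewrite -subr_eq0 opprD addNKr oppr_eq0 => /eqP.
Qed.

Lemma hom_onV a x : hom_on a -> H x -> a x^-1%g = - a x.
Proof.
have [_ _ HV] := sgH; move=> am Hx; apply/eqP; rewrite -addr_eq0 -am ?mulVg ?hom_on1 //.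
exact: HV.
Qed.

Lemma equivariant_hom_on A : equivariant A -> hom_on A.
Proof. by move=> Ae x y Hx _; exact: Ae. Qed.

Lemma extend_equivariant a : hom_on a -> equivariant (fun x => extend a x - extend a 1%g).
Proof.
have [H1 HM HV] := sgH.
move=> am h x Hh; have extM k y : H k -> extend a (k * y)%g = a k + extend a y.
  by move=> Hk; rewrite /extend cls_mull // -mulgA (am _ _ Hk (part_H y)).
by rewrite extM //; have := extM h 1%g Hh; rewrite mulg1 => ->; ring.
Qed.

Lemma extend_hom a x : hom_on a -> H x -> extend a x - extend a 1%g = a x.
Proof.
have [H1 HM HV] := sgH.
move=> am Hx; rewrite -[x in extend a x]mulg1 /extend cls_mull // -mulgA.
by rewrite (am _ _ Hx (part_H _)) addrK.
Qed.

Lemma sum_rep (F : G -> rat) (s : 'I_n -> G) :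
  invariant F -> injective (cls \o s) -> \sum_i F (s i) = \sum_i F (rep i).
Proof.
move=> Fi s_inj; rewrite [RHS](reindex_inj s_inj); apply: eq_bigr => i _ /=.
by have /(Fi _ (rep (cls (s i)))) := part_H (s i); rewrite mulgVK.
Qed.

Lemma sum_rep_mulr (F : G -> rat) k :
  invariant F -> \sum_i F (rep i * k)%g = \sum_i F (rep i).
Proof.
move=> Fi; apply: sum_rep => // i j /= /clsE; rewrite invgM mulgA mulgK => /clsE.
by rewrite !repK.
Qed.

Definition cup_density (A B : G -> rat) (k l x : G) : rat :=
  (A (x * k)%g - A x) * (B (x * k * l)%g - B (x * k)%g).

Definition cup (A B : G -> rat) : G * G -> rat :=
  fun p => \sum_i cup_density A B p.1 p.2 (rep i).

Lemma equivariant_diff A h x k :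
  equivariant A -> H h -> A (h * x * k)%g - A (h * x)%g = A (x * k)%g - A x.
Proof. by move=> Ae Hh; rewrite -mulgA !(Ae h _ Hh); ring. Qed.

Lemma cup_density_invariant A B k l :
  equivariant A -> equivariant B -> invariant (cup_density A B k l).
Proof.
move=> Ae Be h x Hh; rewrite /cup_density equivariant_diff //.
by rewrite -!(mulgA h) !(Be h _ Hh); ring.
Qed.

(** Since x permutes the cosets, the terms of the cocycle identity can be based
    at the same points, where they cancel.  The cocycle is the transfer to G of
    the cup product of two homomorphisms on H. *)
Lemma cup_cocycle A B : equivariant A -> equivariant B -> cocycle (cup A B).
Proof.
move=> Ae Be x y z; rewrite /cup /=.
rewrite -(sum_rep_mulr x (cup_density_invariant y z Ae Be)).
rewrite -sumrB -big_split -sumrB big1 //= => i _.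
by rewrite /cup_density !mulgA; ring.
Qed.

Variable z : {freeg (G * G) / int}.
Hypothesis z_cycle : bar_d2 z = 0.

(** When z is the fundamental cycle of a surface group G, this is the
    intersection form of the covering surface, on its first cohomology. *)
Definition intersection (A B : G -> rat) := pairing (cup A B) z.

Lemma intersection_linl k A A' B :
  intersection (fun x => k * A x + A' x) B = k * intersection A B + intersection A' B.
Proof.
rewrite /intersection -pairing_lin; congr pairing; apply/funext => p.
by rewrite /cup mulr_sumr -big_split; apply: eq_bigr => i _; rewrite /cup_density /=; ring.
Qed.

Lemma intersection_linr k A B B' :
  intersection A (fun x => k * B x + B' x) = k * intersection A B + intersection A B'.
Proof.
rewrite /intersection -pairing_lin; congr pairing; apply/funext => p.
by rewrite /cup mulr_sumr -big_split; apply: eq_bigr => i _; rewrite /cup_density /=; ring.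
Qed.

Lemma pairing_exact c u : (forall k l, c (k, l) = u l - u (k * l)%g + u k) -> pairing c z = 0.
Proof.
move=> cu; have -> : c = cobound u by apply/funext => -[k l]; exact: cu.
by rewrite pairing_cobound z_cycle /pairing fglift0.
Qed.

(** Graded commutativity of the cup product: A u B + B u A is the coboundary of
    -AB. *)
Lemma intersection_anti A B :
  equivariant A -> equivariant B -> intersection A B = - intersection B A.
Proof.
move=> Ae Be; apply/eqP; rewrite -addr_eq0; apply/eqP.
rewrite -[intersection A B]mul1r -pairing_lin.
pose D k x := (A (x * k)%g - A x) * (B (x * k)%g - B x).
have Di k : invariant (D k).
  by move=> h x Hh; rewrite /D !equivariant_diff.
apply: (@pairing_exact _ (fun k => - \sum_i D k (rep i))) => k l /=.
rewrite mul1r /cup -big_split /= -(sum_rep_mulr k (Di l)) opprK.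
rewrite -!sumrN -!big_split /=; apply: eq_bigr => i _.
by rewrite /cup_density /D !mulgA /=; ring.
Qed.

(** When B is a function on the cosets, the cup product is the coboundary of the
    sum of -(A(xk) - A(x)) B(xk) over the cosets of x. *)
Lemma intersection_invariantr A B :
  equivariant A -> invariant B -> intersection A B = 0.
Proof.
move=> Ae Bi; pose D k x := (A (x * k)%g - A x) * B (x * k)%g.
have Di k : invariant (D k).
  by move=> h x Hh; rewrite /D equivariant_diff // -mulgA (Bi h _ Hh).
apply: (@pairing_exact _ (fun k => - \sum_i D k (rep i))) => k l /=.
rewrite /cup /= -(sum_rep_mulr k (Di l)) opprK.
rewrite -!sumrN -!big_split /=; apply: eq_bigr => i _.
by rewrite /cup_density /D !mulgA /=; ring.
Qed.

Lemma intersection_invariantl A B :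
  invariant A -> equivariant A -> equivariant B -> intersection A B = 0.
Proof. by move=> Ai Ae Be; rewrite intersection_anti // intersection_invariantr ?oppr0. Qed.

Lemma equivariant_lin k A B :
  equivariant A -> equivariant B -> equivariant (fun x => k * A x + B x).
Proof. by move=> Ae Be h x Hh; rewrite !(Ae h _ Hh) !(Be h _ Hh); ring. Qed.

Lemma equivariant_diff_invariant A A' :
  equivariant A -> equivariant A' -> (forall h, H h -> A h = A' h) ->
  invariant (fun x => -1 * A' x + A x).
Proof. by move=> Ae A'e AA' h x Hh; rewrite !(Ae h _ Hh) !(A'e h _ Hh) AA' //; ring. Qed.

(** Equivariant functions with the same restriction to H differ by a function on
    the cosets. *)
Lemma intersection_restrict A A' B B' :
  equivariant A -> equivariant A' -> equivariant B -> equivariant B' ->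
  (forall h, H h -> A h = A' h) -> (forall h, H h -> B h = B' h) ->
  intersection A B = intersection A' B'.
Proof.
move=> Ae A'e Be B'e AA' BB'; transitivity (intersection A' B).
  have := intersection_invariantl (equivariant_diff_invariant Ae A'e AA')
    (equivariant_lin (-1) A'e Ae) Be.
  by rewrite intersection_linl mulN1r addrC => /eqP; rewrite subr_eq0 => /eqP.
have := intersection_invariantr A'e (equivariant_diff_invariant Be B'e BB').
by rewrite intersection_linr mulN1r addrC => /eqP; rewrite subr_eq0 => /eqP.
Qed.

(** An automorphism that preserves H permutes its cosets, so it transforms the
    cup product cocycle by composition. *)
Lemma intersection_aut (f : aut G) A B :
  (forall x, H (f x) <-> H x) -> acts_trivially_on_H2 int f ->
  equivariant A -> equivariant B ->
  intersection (A \o f) (B \o f) = intersection A B.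
Proof.
move=> fH f2 Ae Be; rewrite /intersection -(pairing_H2_trivial (cup_cocycle Ae Be) f2 z_cycle).
congr pairing; apply/funext => -[k l]; rewrite /cup /=.
rewrite -(@sum_rep _ (f \o rep) (cup_density_invariant _ _ Ae Be)) => [|i j /= /clsE].
  by apply: eq_bigr => i _; rewrite /cup_density /= !autM.
have fV x : f x^-1%g = (f x)^-1%g by exact: morphV (@autM _ f) _.
by rewrite -fV -autM => /fH /clsE; rewrite !repK.
Qed.

End Transfer.

(** * Linear algebra *)

Section LinearAlgebra.
Local Open Scope ring_scope.
Variable N : nat.

Definition functional (l : 'rV[rat]_N -> rat) :=
  forall k u v, l (k *: u + v) = k * l u + l v.

Lemma functionalE l v : functional l -> l v = \sum_j v 0 j * l (delta_mx 0 j).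
Proof.
move=> ll; have l0 : l 0 = 0.
  by have := ll 1 0 0; rewrite scale1r addr0 mul1r => /(congr1 (fun q => q - l 0)); rewrite subrr addrK => <-.
rewrite {1}(row_sum_delta v); elim: (index_enum 'I_N) => [|j r IH].
  by rewrite !big_nil.
by rewrite !big_cons ll IH.
Qed.

(** The columns of the cokernel of the transposed coefficient matrix lie in the
    common kernel of the L i, so l vanishes on them; this says that l is in the
    column space of the coefficient matrix. *)
Lemma functional_factor n (L : 'I_n -> 'rV[rat]_N -> rat) (l : 'rV[rat]_N -> rat) :
  (forall i, functional (L i)) -> functional l ->
  (forall v, (forall i, L i v = 0) -> l v = 0) ->
  exists c : 'I_n -> rat, forall v, l v = \sum_i c i * L i v.
Proof.
move=> Ll ll Lker.
pose A := \matrix_(j < N, i < n) L i (delta_mx 0 j).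
pose b := \col_(j < N) l (delta_mx 0 j).
have AE v i : (v *m A) 0 i = L i v.
  by rewrite mxE functionalE //; apply: eq_bigr => j _; rewrite mxE.
have bE v : (v *m b) 0 0 = l v.
  by rewrite mxE functionalE //; apply: eq_bigr => j _; rewrite mxE.
have : (b^T <= A^T)%MS.
  rewrite submxE; apply/eqP/trmx_inj; rewrite trmx_mul trmxK trmx0.
  apply/row_matrixP => i; rewrite row_mul row0.
  apply/matrixP=> x y; rewrite !ord1 bE mxE; apply: Lker => j.
  rewrite -AE -row_mul -[A in _ *m A]trmxK -trmx_mul mulmx_coker trmx0.
  by rewrite row0 mxE.
move=> /submxP[D bD]; exists (fun i => D 0 i) => v.
have bE' : b = A *m D^T by rewrite -[b]trmxK bD trmx_mul trmxK.
rewrite -bE bE' mulmxA mxE.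
by apply: eq_bigr => i _; rewrite AE mxE mulrC.
Qed.

(** A set of row vectors that is closed under linear combinations is the row
    space of a matrix, namely of one of maximal rank with rows in the set. *)
Lemma linear_subspace_mx (P : 'rV[rat]_N -> Prop) :
  P 0 -> (forall k u v, P u -> P v -> P (k *: u + v)) ->
  exists U : 'M[rat]_N, forall v, P v <-> (v <= U)%MS.
Proof.
move=> P0 Plin.
pose Q r := `[< exists U : 'M[rat]_N, \rank U = r /\ forall v, (v <= U)%MS -> P v >].
have Q0 : exists r, Q r.
  exists 0%N; apply/asboolP; exists 0; rewrite mxrank0; split=> // v.
  by rewrite submx0 => /eqP ->.
have Qb r : Q r -> (r <= N)%N by move=> /asboolP[U [<- _]]; exact: rank_leq_row.
case: (ex_maxnP Q0 Qb) => r /asboolP[U [rU UP]] rmax.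
exists U => v; split=> [Pv|]; last exact: UP.
have : (\rank (U + v)%MS <= \rank U)%N.
  rewrite rU; apply: rmax; apply/asboolP; exists (U + v)%MS; split=> // w.
  move=> /sub_addsmxP[[a b] /= ->]; rewrite addrC.
  have -> : b *m v = b 0 0 *: v.
    by rewrite -mul_scalar_mx; congr (_ *m _); exact: mx11_scalar.
  by apply: Plin => //; apply: UP; exact: submxMl.
move=> rank_le; apply: submx_trans (addsmxSr U v) _.
by rewrite -(mxrank_leqif_sup (addsmxSl U v)) eqn_leq rank_le mxrankS ?addsmxSl.
Qed.

End LinearAlgebra.

(** * Nondegeneracy of the intersection form *)

Definition surface_proj g : free_group ('I_g + 'I_g)%type -> surface_group g :=
  proj (@surface_rel g).

Lemma surface_projM g : {morph @surface_proj g : x y / x * y}.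
Proof. exact: projM. Qed.

Lemma surface_proj_surj g k : exists x, @surface_proj g x = k.
Proof. exact: proj_surj. Qed.

Section SurfaceDuality.
Variable g : nat.
Local Open Scope ring_scope.

Local Notation X := ('I_g + 'I_g)%type.
Local Notation F := (free_group X).
Local Notation K := (surface_group g).
Local Notation p := (@surface_proj g).

Definition relator : F :=
  (\prod_(i < g) (free_gen (inl i) * free_gen (inr i) *
                  (free_gen (inl i))^-1 * (free_gen (inr i))^-1))%g.

Definition fundamental_cycle : {freeg (K * K) / int} :=
  commutator_cycle (@sa g) (@sb g).

Lemma proj_relator : p relator = 1%g.
Proof. exact: proj_rel. Qed.

Lemma fundamental_cycleP : bar_d2 fundamental_cycle = 0.
Proof.
apply: commutator_cycleP; rewrite -[RHS]proj_relator /relator (morph_prod (@surface_projM g)).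
have E i : (sa i * sb i * (sa i)^-1 * (sb i)^-1 = p (free_gen (inl i) *
    free_gen (inr i) * (free_gen (inl i))^-1 * (free_gen (inr i))^-1))%g.
  by rewrite !surface_projM !(morphV (@surface_projM g)).
by rewrite (eq_bigr _ (fun i _ => E i)).
Qed.

Lemma surface_group_ind (S : set K) :
  subgroup S -> (forall x, S (p (free_gen x))) -> forall k, S k.
Proof.
move=> sgS Sgen k; have [x <-] := surface_proj_surj k.
apply: (free_group_ind (H := [set y | S (p y)])) => //.
exact: (subgroup_preim (@surface_projM g) sgS).
Qed.

Lemma surface_group_fg : finitely_generated [set: K].
Proof.
exists ((fun x : X => p (free_gen x)) @` [set: X]); first exact: finite_image finite_finset.
apply/seteqP; split=> // k _; apply: surface_group_ind => [|x].
  exact: generated_subgroup.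
by apply: generated_sub; exists x.
Qed.

Lemma hom_relator (f : F -> rat) :
  {morph f : x y / (x * y)%g >-> x + y} -> f relator = 0.
Proof.
move=> fM; have f1 : f 1%g = 0 by apply: (addrI (f 1%g)); rewrite -fM mulg1 addr0.
have fV x : f x^-1%g = - f x by apply/eqP; rewrite -addr_eq0 -fM mulVg f1.
rewrite /relator; elim: (index_enum 'I_g) => [|i r IH]; first by rewrite big_nil.
by rewrite big_cons !fM IH !fV; ring.
Qed.

Variables (H : set K) (n : nat) (cls : K -> 'I_n) (rep : 'I_n -> K).
Hypotheses (sgH : subgroup H) (repK : cancel rep cls).
Hypothesis clsE : forall x y, cls x = cls y <-> H (x * y^-1)%g.

Local Notation eqv := (equivariant H).
Local Notation I := (intersection rep fundamental_cycle).

Local Notation N := #|{: X * 'I_n}|.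
Let coord (v : 'rV[rat]_N) (x : X) (i : 'I_n) : rat := v 0 (enum_rank (x, i)).

(* A function v on the edges of the coset graph of H, and its potential. *)
Let pot (v : 'rV[rat]_N) : F -> rat := potential (fun x q => coord v x (cls (p q))).

Let pot_translate v h q : H (p h) -> pot v (h * q)%g = pot v h + pot v q.
Proof.
move=> Hh; apply: potential_translate; first exact: potential1.
move=> r x; rewrite /pot !potentialS [LHS]addrC [RHS]addrC !addKr surface_projM.
by rewrite (cls_mull clsE).
Qed.

Let lift i : F := repr (rep i).
Let p_lift i : p (lift i) = rep i. Proof. by rewrite /surface_proj /proj reprK. Qed.

(* The holonomy of v along the relator, read from the coset i. *)
Let hol i v := pot v (lift i * relator)%g - pot v (lift i).

(* The potential whose value at the relator is the integral of cup A B when v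
   has a potential B on the surface group. *)
Let phi (A : K -> rat) v : F -> rat :=
  potential (fun x q => \sum_i (A (rep i * p q)%g - A (rep i))
                               * coord v x (cls (rep i * p q)%g)).

Let pot_linear k u v q : pot (k *: u + v) q = k * pot u q + pot v q.
Proof.
apply/esym/(@potentialE _ _ _ (fun q => k * pot u q + pot v q)) => [|r x].
  by rewrite /pot !potential1; ring.
by rewrite /pot !potentialS /coord !mxE; ring.
Qed.

Let phi_linear A k u v q : phi A (k *: u + v) q = k * phi A u q + phi A v q.
Proof.
apply/esym/(@potentialE _ _ _ (fun q => k * phi A u q + phi A v q)) => [|r x].
  by rewrite /phi !potential1; ring.
rewrite /phi !potentialS mulrDr addrACA mulr_sumr -big_split; congr (_ + _).
by apply: eq_bigr => i _; rewrite /coord !mxE /=; ring.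
Qed.

(* Without holonomy the potential descends to the surface group. *)
Let pot_descends v : (forall i, hol i v = 0) ->
  exists2 B : K -> rat, eqv B & forall q, pot v q = B (p q).
Proof.
move=> hol0.
have potN q r : normal_closure (@surface_rel g) r -> pot v (q * r)%g = pot v q.
  have potE a b c : cls (p a) = cls (p b) -> pot v (a * c)%g - pot v a = pot v (b * c)%g - pot v b.
    move=> /clsE; rewrite -(morphV (@surface_projM g)) -surface_projM => Hab.
    have := pot_translate v (b * c)%g Hab; have := pot_translate v b Hab.
    by rewrite mulgVK mulgA mulgVK => -> ->; ring.
  pose M := [set r | p r = 1%g /\ forall q, pot v (q * r)%g = pot v q].
  suff : normal_closure (@surface_rel g) `<=` M by move=> sub /sub[].
  apply: smallest_sub.
    split; first split.
    - by split=> [|a]; rewrite ?(morph1 (@surface_projM g)) // mulg1.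
    - move=> a b [pa fa] [pb fb]; split=> [|c]; first by rewrite surface_projM pa pb mulg1.
      by rewrite mulgA fb fa.
    - move=> a [pa fa]; split=> [|c]; first by rewrite (morphV (@surface_projM g)) pa invg1.
      by rewrite -(fa (c * a^-1)%g) mulgVK.
    - move=> a b [pa fa]; split=> [|c].
        by rewrite /conjg !surface_projM pa mul1g -surface_projM mulVg (morph1 (@surface_projM g)).
      have := potE (c * b^-1 * a)%g (c * b^-1)%g b; rewrite surface_projM pa mulg1 => /(_ erefl).
      by rewrite fa mulgVK /conjg !mulgA => /(addIr (- _)).
  move=> _ ->; split=> [|a]; first exact: proj_relator.
  have := potE a (lift (cls (p a))) relator; rewrite p_lift repK => /(_ erefl).
  by rewrite -/(hol _ v) hol0 => /eqP; rewrite subr_eq0 => /eqP.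
have BE q : pot v q = pot v (repr (p q)).
  have /potN : normal_closure (@surface_rel g) ((repr (p q))^-1 * q)%g.
    exact: repr_proj.
  by move=> /(_ (repr (p q))); rewrite mulVKg.
exists (fun k => pot v (repr k)) => // h x Hh.
have [a pa] := surface_proj_surj h; have [b pb] := surface_proj_surj x.
rewrite -pa -pb -surface_projM -!BE; apply: pot_translate.
by rewrite pa.
Qed.

Let intersection_phi A B v : eqv A -> eqv B -> (forall q, pot v q = B (p q)) ->
  I A B = phi A v relator.
Proof.
move=> Ae Be vB; pose c := cup rep A B.
have cc : cocycle c := cup_cocycle repK clsE Ae Be.
have c1 k : c (k, 1%g) = 0.
  by rewrite /c /cup big1 // => i _; rewrite /cup_density mulg1 subrr mulr0.
have cS q x : \sum_i (A (rep i * p q)%g - A (rep i)) * coord v x (cls (rep i * p q)%g) =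
              c (p q, p (free_gen x)).
  rewrite /c /cup; apply: eq_bigr => i _; rewrite /cup_density; congr (_ * _).
  by rewrite -p_lift -!surface_projM -!vB /pot potentialS; ring.
have phiM q r : phi A v (q * r)%g = phi A v q + phi A v r + c (p q, p r).
  have := @potential_unique _ _ (fun r => phi A v (q * r)%g - c (p q, p r)) (phi A v) _ 1%g r.
  rewrite mulg1 (morph1 (@surface_projM g)) c1 subr0 /phi potential1 subr0 => <- => [|b x].
    by ring.
  rewrite mulgA !potentialS !cS !surface_projM.
  by have := cc (p q) (p b) (p (free_gen x)); lra.
rewrite /intersection -/c /fundamental_cycle.
exact: (pairing_commutator_cycle (fun i => free_gen (inl i) : F)
  (fun i => free_gen (inr i)) (@surface_projM g) (c1 _) phiM).
Qed.

(* A function m on the cosets contributes to phi a potential which differs from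
   minus the combination chi of increments of pot v by a homomorphism, and every
   homomorphism to an abelian group vanishes at the relator. *)
Let phi_shift A (m : 'I_n -> rat) v :
  phi (fun k => A k + m (cls k)) v relator =
  phi A v relator - \sum_i m i * hol i v.
Proof.
pose chi q := \sum_i m i * (pot v (lift i * q)%g - pot v (lift i)).
pose f q := phi (fun k => A k + m (cls k)) v q - phi A v q + chi q.
have chi1 : chi 1%g = 0 by rewrite /chi big1 // => i _; rewrite mulg1 subrr mulr0.
have f1 : f 1%g = 0 by rewrite /f /phi !potential1 chi1; ring.
pose e x := \sum_i m i * coord v x i.
have fS q x : f (q * free_gen x)%g = f q + e x.
  have -> : e x = \sum_i m (cls (rep i * p q)%g) * coord v x (cls (rep i * p q)%g).
    rewrite /e (reindex_inj (h := fun i => cls (rep i * p q)%g)) //.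
    move=> i j /clsE; rewrite invgM mulgA mulgK => /clsE; rewrite !repK; exact.
  have phiS A' : phi A' v (q * free_gen x)%g = phi A' v q +
      \sum_i (A' (rep i * p q)%g - A' (rep i)) * coord v x (cls (rep i * p q)%g).
    exact: potentialS.
  have chiS : chi (q * free_gen x)%g = chi q + \sum_i m i * coord v x (cls (rep i * p q)%g).
    rewrite /chi -big_split; apply: eq_bigr => i _ /=.
    by rewrite mulgA /pot potentialS surface_projM p_lift; ring.
  transitivity (f q + (\sum_i (A (rep i * p q)%g + m (cls (rep i * p q)%g) -
      (A (rep i) + m (cls (rep i)))) * coord v x (cls (rep i * p q)%g) -
     \sum_i (A (rep i * p q)%g - A (rep i)) * coord v x (cls (rep i * p q)%g) +
     \sum_i m i * coord v x (cls (rep i * p q)%g))).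
    by rewrite /f !phiS chiS; ring.
  congr (_ + _); rewrite -sumrB -big_split; apply: eq_bigr => i _ /=.
  by rewrite repK; ring.
have : f relator = 0.
  apply: hom_relator => q r; apply: potential_translate => // b x.
  by rewrite !fS [LHS]addrC [RHS]addrC !addKr.
by rewrite /f /chi /hol => /eqP; rewrite addr_eq0 subr_eq => /eqP ->; rewrite addrC.
Qed.

Section TestEdges.
Variable A : K -> rat.
Hypothesis A_diff : forall h x k, H h ->
  A (h * x * k)%g - A (h * x)%g = A (x * k)%g - A x.

(* phi A on the characteristic function of the edge labelled s into the coset
   of y. *)
Let edge s y : F -> rat :=
  potential (fun x q => (x == s)%:R * (A y - A (y * (p q)^-1)%g)).

Let phi_edge s y : phi A (delta_mx 0 (enum_rank (s, cls y))) =1 edge s y.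
Proof.
rewrite /phi /edge => q; congr (potential _ q); apply/funext => x; apply/funext => r.
pose i0 := cls (y * (p r)^-1)%g.
have clsE' i : (cls (rep i * p r)%g == cls y) = (i == i0).
  apply/eqP/eqP => [/clsE Hi|->].
    by rewrite -[i]repK; apply/clsE; rewrite invgM invgK mulgA.
  by apply/clsE; rewrite -[p r in X in H X]invgK -mulgA -invgM; apply/clsE; rewrite repK.
rewrite (bigD1 i0) //= big1 ?addr0 => [|i neq_i]; last first.
  rewrite /coord mxE (inj_eq enum_rank_inj) xpair_eqE clsE' (negPf neq_i).
  by rewrite andbF andbF mulr0.
rewrite /coord mxE (inj_eq enum_rank_inj) xpair_eqE clsE' !eqxx /= andbT mulrC.
congr (_ * _); have Hh : H (rep i0 * (y * (p r)^-1)^-1)%g by apply/clsE; rewrite repK.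
have := @A_diff _ (y * (p r)^-1)%g (p r) Hh.
by rewrite !mulgVK.
Qed.

Hypothesis phi0 : forall v, phi A v relator = 0.

Let edge0 s y : edge s y relator = 0.
Proof. by rewrite -phi_edge. Qed.

Let edgeS s y q x : edge s y (q * free_gen x)%g =
  edge s y q + (x == s)%:R * (A y - A (y * (p q)^-1)%g).
Proof. exact: potentialS. Qed.

Let edgeSV s y q x : edge s y (q * (free_gen x)^-1)%g =
  edge s y q - (x == s)%:R * (A y - A (y * (p (q * (free_gen x)^-1))^-1)%g).
Proof. exact: potentialSV. Qed.

Let u i : F := free_gen (inl i).
Let v i : F := free_gen (inr i).
Let comm i : F := (u i * v i * (u i)^-1 * (v i)^-1)%g.
Let index_of (s : X) : 'I_g := match s with inl i => i | inr i => i end.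

Let edge_comm s y q i : index_of s != i -> edge s y (q * comm i)%g = edge s y q.
Proof.
move=> neq; rewrite /comm !mulgA !edgeSV !edgeS.
have -> : (inl i == s) = false.
  by apply/eqP => E; move: neq; rewrite -E /= eqxx.
have -> : (inr i == s) = false.
  by apply/eqP => E; move: neq; rewrite -E /= eqxx.
by rewrite /=; ring.
Qed.

Let edge_prod s y q r : index_of s \notin r ->
  edge s y (q * \prod_(i <- r) comm i)%g = edge s y q.
Proof.
elim: r q => [|i r IH] q; first by rewrite big_nil mulg1.
rewrite inE negb_or => /andP[neq notin]; rewrite big_cons mulgA IH //.
exact: edge_comm.
Qed.

Let fixes q := forall y, A (y * p q)%g = A y.

Let fixes_subgroup : subgroup [set q | fixes q].
Proof.
split=> /= [y|a b fa fb y|a fa y].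
- by rewrite (morph1 (@surface_projM g)) mulg1.
- by rewrite surface_projM mulgA fb fa.
- by rewrite (morphV (@surface_projM g)) -(fa (y * _)%g) mulgVK.
Qed.

Let fixesP q : fixes q -> forall y, A (y * (p q)^-1)%g = A y.
Proof.
move=> fq y; rewrite -(morphV (@surface_projM g)).
by have [_ _ /(_ q fq)] := fixes_subgroup; exact.
Qed.

(* The two edges of the i-th handle, once A is invariant under the previous
   handles: they say that A agrees at the corners of the polygon that the
   gluing identifies. *)
Let handle r1 i r2 : index_enum 'I_g = r1 ++ i :: r2 ->
  fixes (\prod_(j <- r1) comm j)%g -> fixes (u i) /\ fixes (v i).
Proof.
move=> E; set P := (\prod_(j <- r1) comm j)%g => fP.
have uniqE : uniq (r1 ++ i :: r2) by rewrite -E; exact: index_enum_uniq.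
have [i1 i2] : i \notin r1 /\ i \notin r2.
  by move: uniqE; rewrite cat_uniq /= => /and3P[_ /norP[? _] /andP[? _]].
have relE : relator = (P * comm i * \prod_(j <- r2) comm j)%g.
  by rewrite /relator -mulgA -[RHS]/(_) E big_cat big_cons.
have P0 s y : index_of s = i -> edge s y P = 0.
  move=> si; rewrite -[P]mul1g edge_prod ?si // /edge; exact: potential1.
have rel0 s y : index_of s = i -> edge s y (P * comm i)%g = 0.
  by move=> si; rewrite -[RHS](edge0 s y) relE edge_prod ?si.
have fPV y a : A (y * (p (P * a))^-1)%g = A (y * (p a)^-1)%g.
  by rewrite surface_projM invgM mulgA (fixesP fP).
have pV := morphV (@surface_projM g).
have E1 y : A y = A (y * p (u i) * (p (v i))^-1 * (p (u i))^-1)%g.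
  have := rel0 (inl i) y erefl; rewrite /comm !mulgA edgeSV edgeSV edgeS edgeS.
  rewrite P0 // eqxx /= !mul0r !mul1r.
  rewrite (fixesP fP) -!(mulgA P) fPV !surface_projM !pV !invgM !invgK !mulgA.
  by move=> e; lra.
have E2 y : A (y * (p (u i))^-1)%g = A (y * p (v i) * p (u i) * (p (v i))^-1 * (p (u i))^-1)%g.
  have := rel0 (inr i) y erefl; rewrite /comm !mulgA edgeSV edgeSV edgeS edgeS.
  rewrite P0 // eqxx /= !mul0r !mul1r.
  rewrite -!(mulgA P) !fPV !surface_projM !pV !invgM !invgK !mulgA.
  by move=> e; lra.
have E3 y : A (y * (p (v i))^-1 * (p (u i))^-1)%g = A y.
  by have := E2 (y * (p (v i))^-1)%g; rewrite mulgVK -E1.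
have fu : fixes (u i).
  have [_ _ fixesV] := fixes_subgroup.
  rewrite -[u i]invgK; apply: fixesV => y /=.
  by rewrite pV E1 mulgVK E3.
split=> //; have [_ _ fixesV] := fixes_subgroup.
rewrite -[v i]invgK; apply: fixesV => y /=.
by rewrite pV -(fixesP fu) E3.
Qed.

Lemma invariant_of_edges k : A k = A 1%g.
Proof.
have fixes_r r2 r1 : index_enum 'I_g = r1 ++ r2 ->
    (forall j, j \in r1 -> fixes (u j) /\ fixes (v j)) ->
    forall j, fixes (u j) /\ fixes (v j).
  elim: r2 r1 => [|i r2 IH] r1 E f1 j.
    by apply: f1; rewrite -[r1]cats0 -E mem_index_enum.
  apply: (IH (rcons r1 i)); first by rewrite cat_rcons.
  move=> l; rewrite mem_rcons inE => /orP[/eqP ->|/f1//].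
  apply: (handle E) => {E IH}; have [fix1 fixM fixV] := fixes_subgroup.
  elim: r1 f1 => [|a r1 IH] f1; first by rewrite big_nil.
  rewrite big_cons; apply: (fixM); last first.
    by apply: IH => b br; apply: f1; rewrite inE br orbT.
  have [fu fv] : fixes (u a) /\ fixes (v a) by apply: f1; rewrite mem_head.
  by rewrite /comm; do !apply: (fixM) => //; apply: (fixV).
have fixes_gen j : fixes (u j) /\ fixes (v j) by exact: (fixes_r (index_enum 'I_g) [::]).
have fixes_all : forall q, fixes q.
  apply: free_group_ind; first exact: fixes_subgroup.
  by case=> j; have [] := fixes_gen j.
by have [q <-] := surface_proj_surj k; rewrite -{1}[p q]mul1g fixes_all.
Qed.

End TestEdges.

(** Poincare duality.  A class A that is orthogonal to all cocycles yields a
    functional on edge functions which vanishes when the holonomy does, hence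
    is a combination of holonomies; after a change of A by a coboundary it is
    zero, and then A is constant. *)
Lemma intersection_nondegenerate A :
  eqv A -> (forall B, eqv B -> I A B = 0) -> forall h, H h -> A h = 0.
Proof.
move=> Ae A0 h Hh.
have [m mE] : exists c : 'I_n -> rat, forall v, phi A v relator = \sum_i c i * hol i v.
  apply: functional_factor => [i k v w|k v w|v v0].
  - by rewrite /hol !pot_linear; ring.
  - exact: phi_linear.
  - by have [B Be vB] := pot_descends v0; rewrite -(intersection_phi Ae Be vB) A0.
pose A' k := A k + m (cls k).
have A'_diff l x k : H l -> A' (l * x * k)%g - A' (l * x)%g = A' (x * k)%g - A' x.
  move=> Hl; rewrite /A' -!mulgA !(cls_mull clsE _ Hl).
  by rewrite !(Ae l _ Hl); ring.
have A'0 v : phi A' v relator = 0 by rewrite phi_shift mE subrr.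
have := invariant_of_edges A'_diff A'0 h.
rewrite /A' -{2}[h]mulg1 (cls_mull clsE _ Hh) => /addIr ->.
have [H1 _ _] := sgH; have := Ae 1%g 1%g H1; rewrite mulg1; lra.
Qed.

End SurfaceDuality.

(** * The first homology of a finitely generated subgroup *)

Section FirstHomology.
Variables (G : groupType) (H : set G).
Hypothesis sgH : subgroup H.
Local Open Scope ring_scope.

Local Notation chain1 := {freeg G / rat}.
Local Notation B1H := (B1 (R := rat) H).

Definition value (a : G -> rat) (c : chain1) : rat := fglift (a : G -> rat^o) c.

Lemma valueU a x : value a << x >> = a x.
Proof. by rewrite /value fgliftU. Qed.

Lemma valueD a : {morph value a : c d / c + d}.
Proof. by move=> c d; rewrite /value fgliftD. Qed.

Lemma valueB a : {morph value a : c d / c - d}.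
Proof. by move=> c d; rewrite /value fgliftB. Qed.

Lemma valueZ a k c : value a (k *: c) = k * value a c.
Proof. by rewrite /value fgliftZ. Qed.

Lemma value_sum a I (r : seq I) (F : I -> chain1) :
  value a (\sum_(i <- r) F i) = \sum_(i <- r) value a (F i).
Proof. by rewrite /value fglift_sum. Qed.

Lemma value_dom a c : value a c = \sum_(x <- dom c) coeff x c * a x.
Proof. by rewrite /value fglift_dom. Qed.

Lemma value_lin k a b c : value (fun x => k * a x + b x) c = k * value a c + value b c.
Proof.
by rewrite !value_dom mulr_sumr -big_split; apply: eq_bigr => x _ /=; ring.
Qed.

Lemma eq_value a b c : C1 H c -> (forall x, H x -> a x = b x) -> value a c = value b c.
Proof.
move=> Hc ab; rewrite !value_dom; apply: eq_big_seq => x xc.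
by rewrite ab //; exact: Hc.
Qed.

Lemma value_chain1_map a (f : G -> G) c : value a (chain1_map f c) = value (a \o f) c.
Proof.
rewrite /chain1_map (fglift_dom (fun x => << f x >>)) value_sum value_dom.
by apply: eq_bigr => x _; rewrite valueZ valueU.
Qed.

Lemma bar_d2U x y : bar_d2 << (x, y) >> = << y >> - << (x * y)%g >> + << x >> :> chain1.
Proof. by rewrite /bar_d2 fgliftU. Qed.

Lemma C1_0 : C1 H (0 : chain1).
Proof. by move=> x; rewrite dom0. Qed.

Lemma C1_lin k (c d : chain1) : C1 H c -> C1 H d -> C1 H (k *: c + d).
Proof.
move=> Hc Hd x /domD_subset; rewrite mem_cat => /orP[/domZ_subset|]; last exact: Hd.
exact: Hc.
Qed.

Lemma C1_U x : H x -> C1 H (<< x >> : chain1).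
Proof. by move=> Hx y; rewrite domU1 inE => /eqP ->. Qed.

Lemma C1_sum I (r : seq I) (F : I -> chain1) k :
  (forall i, C1 H (F i)) -> C1 H (\sum_(i <- r) k i *: F i).
Proof.
move=> HF; elim: r => [|i r IH]; first by rewrite big_nil; exact: C1_0.
by rewrite big_cons; exact: C1_lin.
Qed.

Lemma B1_0 : B1H 0.
Proof. by exists 0; [move=> q; rewrite dom0 | rewrite /bar_d2 fglift0]. Qed.

Lemma B1_lin k c d : B1H c -> B1H d -> B1H (k *: c + d).
Proof.
move=> [c' Hc <-] [d' Hd <-]; exists (k *: c' + d').
  move=> q /domD_subset; rewrite mem_cat => /orP[/domZ_subset|]; last exact: Hd.
  exact: Hc.
by rewrite /bar_d2 fgliftD fgliftZ.
Qed.

Lemma B1_D c d : B1H c -> B1H d -> B1H (c + d).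
Proof. by move=> Hc Hd; rewrite -[c]scale1r; exact: B1_lin. Qed.

Lemma B1_N c : B1H c -> B1H (- c).
Proof. by move=> Hc; rewrite -[- c]addr0 -scaleN1r; exact: B1_lin B1_0. Qed.

Lemma B1_U x y : H x -> H y -> B1H (<< y >> - << (x * y)%g >> + << x >>).
Proof.
move=> Hx Hy; exists << (x, y) >>; last exact: bar_d2U.
by move=> q; rewrite domU1 inE => /eqP ->.
Qed.

(** A homomorphism on H is a function on the first homology of H. *)
Lemma value_B1 a c : hom_on H a -> B1H c -> value a c = 0.
Proof.
move=> am [d Hd <-]; rewrite /bar_d2 (fglift_dom (fun q : G * G => _)) value_sum.
rewrite big_seq big1 // => -[x y] /Hd[/= Hx Hy].
by rewrite valueZ valueD valueB !valueU am //; ring.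
Qed.

Variables (r : nat) (s : 'I_r -> G).
Hypothesis s_gen : generated (range s) = H.

Definition comb (m : 'rV[rat]_r) : chain1 := \sum_j m 0 j *: << s j >>.

Lemma gen_H j : H (s j).
Proof. by rewrite -s_gen; apply: generated_sub; exists j. Qed.

Lemma comb_C1 m : C1 H (comb m).
Proof. by apply: C1_sum => j; apply: C1_U; exact: gen_H. Qed.

Lemma comb_lin k m m' : comb (k *: m + m') = k *: comb m + comb m'.
Proof.
rewrite /comb scaler_sumr -big_split; apply: eq_bigr => j _ /=.
by rewrite !mxE scalerDl scalerA.
Qed.

Lemma value_comb a m : value a (comb m) = \sum_j m 0 j * a (s j).
Proof. by rewrite /comb value_sum; apply: eq_bigr => j _; rewrite valueZ valueU. Qed.

Lemma combD m m' : comb (m + m') = comb m + comb m'.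
Proof. by rewrite -{1}[m]scale1r comb_lin scale1r. Qed.

Lemma combN m : comb (- m) = - comb m.
Proof. by rewrite /comb -sumrN; apply: eq_bigr => j _; rewrite mxE scaleNr. Qed.

Lemma comb_delta j : comb (delta_mx 0 j) = << s j >>.
Proof.
rewrite /comb (bigD1 j) //= big1 ?addr0 => [|i /negPf ij]; rewrite mxE eqxx.
  by rewrite eqxx scale1r.
by rewrite ij scale0r.
Qed.

Lemma class_of_gen x : H x -> exists m, B1H (<< x >> - comb m).
Proof.
move=> Hx; pose S := [set x | H x /\ exists m, B1H (<< x >> - comb m)].
suff : H `<=` S by move=> /(_ x Hx)[].
have [H1 HM HV] := sgH.
rewrite -{1}s_gen; apply: generated_min; last first.
  move=> _ [j _ <-]; split; first exact: gen_H.
  by exists (delta_mx 0 j); rewrite comb_delta subrr; exact: B1_0.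
have S1 : B1H << 1%g >> by have := B1_U H1 H1; rewrite mulg1 subrr add0r.
split=> [|y z [Hy [m ym]] [Hz [m' zm]]|y [Hy [m ym]]].
- split=> //; exists 0; have -> : comb 0 = 0.
    by rewrite /comb big1 // => j _; rewrite mxE scale0r.
  by rewrite subr0.
- split; first exact: HM.
  exists (m + m'); rewrite combD.
  have := B1_D (B1_N (B1_U Hy Hz)) (B1_D ym zm).
  congr (B1H _); apply/eqP/freeg_eqP => t.
  by rewrite !(coeffD, coeffN); ring.
- split; first exact: HV.
  exists (- m); rewrite combN opprK.
  have := B1_D (B1_D (B1_U (HV _ Hy) Hy) S1) (B1_N ym).
  rewrite mulVg; congr (B1H _); apply/eqP/freeg_eqP => t.
  by rewrite !(coeffD, coeffN); ring.
Qed.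

Lemma class_of_chain c : C1 H c -> exists m, B1H (c - comb m).
Proof.
move=> Hc; rewrite -(freeg_sumE c); move: (Hc : forall x, x \in dom c -> H x).
elim: (dom c) => [|x l IH] Hl.
  exists 0; rewrite big_nil sub0r; apply: B1_N.
  have -> : comb 0 = 0 by rewrite /comb big1 // => j _; rewrite mxE scale0r.
  exact: B1_0.
have [y yl|m mE] := IH; first by apply: Hl; rewrite inE yl orbT.
have [m' m'E] : exists m, B1H (<< x >> - comb m).
  by apply: class_of_gen; apply: Hl; rewrite mem_head.
exists (coeff x c *: m' + m); rewrite big_cons comb_lin.
have := B1_lin (coeff x c) m'E mE.
congr (B1H _); apply/eqP/freeg_eqP => t.
by rewrite !(coeffD, coeffN, coeffZ, coeffU); ring.
Qed.

(** A chain on which every homomorphism vanishes is a boundary: modulo the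
    boundaries it is a combination of the generators, and a coordinate of the
    quotient of the space of combinations by the boundaries is a homomorphism
    on H. *)
Lemma B1P c : C1 H c -> (forall a, hom_on H a -> value a c = 0) -> B1H c.
Proof.
move=> Hc c0; have [H1 HM HV] := sgH.
have [U UP] : exists U : 'M[rat]_r, forall m, B1H (comb m) <-> (m <= U)%MS.
  apply: linear_subspace_mx => [|k u v Hu Hv]; last by rewrite comb_lin; exact: B1_lin.
  have -> : comb 0 = 0 by rewrite /comb big1 // => j _; rewrite mxE scale0r.
  exact: B1_0.
pose C := cokermx U; have UC m : B1H (comb m) -> m *m C = 0.
  by move=> /UP /submxP[D ->]; rewrite -mulmxA mulmx_coker mulmx0.
pose m_of x := xget 0 [set m | B1H (<< x >> - comb m)].
have m_ofP x : H x -> B1H (<< x >> - comb (m_of x)).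
  by move=> /class_of_gen[m mx]; rewrite /m_of; case: xgetP => // /(_ m).
pose a j x := (m_of x *m C) 0 j.
have am j : hom_on H (a j).
  move=> x y Hx Hy; transitivity ((m_of x *m C + m_of y *m C) 0 j); last by rewrite mxE.
  rewrite /a -mulmxDl; congr (fun_of_matrix _ 0 j).
  apply/eqP; rewrite -subr_eq0 -mulmxBl; apply/eqP; apply: UC.
  have := B1_D (B1_D (B1_U Hx Hy) (m_ofP _ (HM _ _ Hx Hy)))
               (B1_N (B1_D (m_ofP _ Hx) (m_ofP _ Hy))).
  move=> /B1_N; congr (B1H _); apply/eqP/freeg_eqP => t.
  by rewrite !(combD, combN) !(coeffD, coeffN); ring.
have [m mE] := class_of_chain Hc.
suff /UP Bm : (m <= U)%MS by have := B1_D mE Bm; rewrite addrNK.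
rewrite submxE -/C; apply/eqP/matrixP => i j; rewrite !ord1 [RHS]mxE.
have := value_B1 (am j) mE; rewrite valueB c0 // sub0r => /eqP.
rewrite oppr_eq0 value_comb => /eqP <-; rewrite mxE; apply: eq_bigr => l _.
congr (_ * _); rewrite /a.
have /UC : B1H (comb (m_of (s l) - delta_mx 0 l)).
  have := B1_N (m_ofP _ (gen_H l)); congr (B1H _).
  by rewrite combD combN comb_delta opprB.
rewrite mulmxBl -rowE => /eqP; rewrite subr_eq0 => /eqP ->.
by rewrite [RHS]mxE.
Qed.

Lemma hom_on_lin k a b : hom_on H a -> hom_on H b -> hom_on H (fun x => k * a x + b x).
Proof. by move=> am bm x y Hx Hy; rewrite am // bm //; ring. Qed.

Lemma hom_on0 : hom_on H (fun=> 0).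
Proof. by move=> x y _ _; rewrite addr0. Qed.

Lemma hom_on_gen a b : hom_on H a -> hom_on H b -> (forall j, a (s j) = b (s j)) ->
  forall x, H x -> a x = b x.
Proof.
move=> am bm ab; have [H1 HM HV] := sgH.
suff : H `<=` [set x | H x /\ a x = b x] by move=> sub x /sub[].
rewrite -{1}s_gen; apply: generated_min; last first.
  by move=> _ [j _ <-]; split; [exact: gen_H | exact: ab].
split=> [|x y [Hx abx] [Hy aby]|x [Hx abx]].
- by split; rewrite // !(hom_on1 sgH).
- by split; [exact: HM | rewrite am // bm // abx aby].
- by split; [exact: HV | rewrite !(hom_onV sgH) // abx].
Qed.

Definition lincomb (a : 'I_r -> G -> rat) (t : 'rV[rat]_r) : G -> rat :=
  fun x => \sum_i t 0 i * a i x.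

Lemma lincomb_hom_on a t : (forall i, hom_on H (a i)) -> hom_on H (lincomb a t).
Proof.
move=> am x y Hx Hy; rewrite /lincomb -big_split; apply: eq_bigr => i _ /=.
by rewrite am // mulrDr.
Qed.

Lemma lincomb_lin a k t u :
  lincomb a (k *: t + u) = (fun x => k * lincomb a t x + lincomb a u x).
Proof.
apply/funext => x; rewrite /lincomb mulr_sumr -big_split; apply: eq_bigr => i _ /=.
by rewrite !mxE; ring.
Qed.

(** A homomorphism is determined by its values on the generators, so the space
    of homomorphisms has finite dimension. *)
Lemma hom_span : exists a : 'I_r -> G -> rat, (forall i, hom_on H (a i)) /\
  forall b, hom_on H b -> exists t, forall x, H x -> b x = lincomb a t x.
Proof.
pose P (v : 'rV[rat]_r) := exists2 b, hom_on H b & forall j, b (s j) = v 0 j.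
have [V VP] : exists V : 'M[rat]_r, forall v, P v <-> (v <= V)%MS.
  apply: linear_subspace_mx => [|k u v [a am au] [b bm bv]].
    by exists (fun=> 0); [exact: hom_on0 | move=> j; rewrite mxE].
  by exists (fun x => k * a x + b x); [exact: hom_on_lin | move=> j; rewrite au bv !mxE].
have /choice[a aP] : forall i, exists b, hom_on H b /\ forall j, b (s j) = V i j.
  move=> i; have /VP[b bm bv] : (row i V <= V)%MS by exact: row_sub.
  by exists b; split=> // j; rewrite bv mxE.
have am i : hom_on H (a i) by have [] := aP i.
exists a; split=> // b bm.
have /VP/submxP[t tE] : P (\row_j b (s j)) by exists b => // j; rewrite mxE.
exists t; apply: hom_on_gen => //; first exact: lincomb_hom_on.
move=> j; have := congr1 (fun v : 'rV_r => v 0 j) tE; rewrite mxE => ->.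
by rewrite mxE; apply: eq_bigr => i _; have [_ ->] := aP i.
Qed.

(** Evaluations at the generators separate the homomorphisms, so every functional
    is a combination of them, hence the evaluation at a chain. *)
Lemma hom_functional_chain (l : (G -> rat) -> rat) :
  (forall k a b, hom_on H a -> hom_on H b ->
     l (fun x => k * a x + b x) = k * l a + l b) ->
  (forall a b, hom_on H a -> hom_on H b -> (forall x, H x -> a x = b x) -> l a = l b) ->
  exists2 c : chain1, C1 H c & forall a, hom_on H a -> l a = value a c.
Proof.
move=> ll l_eq; have [a [am a_span]] := hom_span.
have ah t : hom_on H (lincomb a t) by exact: lincomb_hom_on.
have [m mE] : exists m : 'I_r -> rat,
    forall t, l (lincomb a t) = \sum_j m j * lincomb a t (s j).
  apply: functional_factor => [j k t u|k t u|t t0].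
  - by rewrite lincomb_lin.
  - by rewrite lincomb_lin ll.
  - have l0 : l (fun=> 0) = 0.
      by have := ll (-1) _ _ hom_on0 hom_on0; rewrite mulr0 addr0; lra.
    apply: etrans l0; apply: (l_eq _ _ (ah t) hom_on0).
    exact: (hom_on_gen (ah t) hom_on0 t0).
exists (comb (\row_j m j)); first exact: comb_C1.
move=> b bm; have [t tE] := a_span b bm.
rewrite (l_eq _ _ bm (ah t)) // mE value_comb; apply: eq_bigr => j _.
by rewrite mxE tE //; exact: gen_H.
Qed.

(** For a spanning family a, the functionals w (-) (a j) have no common zero on
    the homomorphisms, so evaluation at c is one of their combinations. *)
Lemma form_represents_chain (w : (G -> rat) -> (G -> rat) -> rat) c :
  (forall k a a' b, hom_on H a -> hom_on H a' -> hom_on H b ->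
     w (fun x => k * a x + a' x) b = k * w a b + w a' b) ->
  (forall k a b b', hom_on H a -> hom_on H b -> hom_on H b' ->
     w a (fun x => k * b x + b' x) = k * w a b + w a b') ->
  (forall a a' b b', hom_on H a -> hom_on H a' -> hom_on H b -> hom_on H b' ->
     (forall x, H x -> a x = a' x) -> (forall x, H x -> b x = b' x) -> w a b = w a' b') ->
  (forall a, hom_on H a -> (forall b, hom_on H b -> w a b = 0) -> forall x, H x -> a x = 0) ->
  C1 H c ->
  exists2 b, hom_on H b & forall a, hom_on H a -> w a b = value a c.
Proof.
move=> wl wr w_eq w_nd Hc; have [a [am a_span]] := hom_span.
have ah t : hom_on H (lincomb a t) by exact: lincomb_hom_on.
have w0 b : hom_on H b -> w b (fun=> 0) = 0.
  by move=> bm; have := wr (-1) _ _ _ bm hom_on0 hom_on0; rewrite mulr0 addr0; lra.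
have w_sum b (m : 'I_r -> rat) : hom_on H b ->
    w b (lincomb a (\row_j m j)) = \sum_j m j * w b (a j).
  move=> bm; have -> : lincomb a (\row_j m j) = fun x => \sum_j m j * a j x.
    by apply/funext => x; apply: eq_bigr => j _; rewrite mxE.
  suff [] : hom_on H (fun x => \sum_j m j * a j x) /\
      w b (fun x => \sum_j m j * a j x) = \sum_j m j * w b (a j) by [].
  elim: (index_enum 'I_r) => [|j l [IHm IH]].
    have -> : (fun x : G => \sum_(j <- [::]) m j * a j x) = fun=> 0.
      by apply/funext => x; rewrite big_nil.
    by rewrite big_nil w0 //; split=> //; exact: hom_on0.
  have -> : (fun x : G => \sum_(i <- j :: l) m i * a i x) =
            fun x => m j * a j x + \sum_(i <- l) m i * a i x.
    by apply/funext => x; rewrite big_cons.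
  by rewrite big_cons wr // IH; split=> //; exact: hom_on_lin.
have [m mE] : exists m : 'I_r -> rat,
    forall t, value (lincomb a t) c = \sum_j m j * w (lincomb a t) (a j).
  apply: functional_factor => [j k t u|k t u|t t0].
  - by rewrite lincomb_lin wl.
  - by rewrite lincomb_lin value_lin.
  - rewrite (eq_value (b := fun=> 0) Hc) => [|x Hx].
      by rewrite value_dom big1 // => x _; rewrite mulr0.
    apply: (w_nd _ (ah t)) => // b bm; have [u uE] := a_span b bm.
    rewrite (w_eq _ (lincomb a t) _ (lincomb a u)) //.
    have -> : u = \row_j u 0 j by apply/rowP => j; rewrite mxE.
    by rewrite w_sum // big1 // => j _; rewrite t0 mulr0.
exists (lincomb a (\row_j m j)) => // b bm.
have [t tE] := a_span b bm.
rewrite (w_eq _ (lincomb a t) _ (lincomb a (\row_j m j))) //.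
by rewrite w_sum // -mE; apply: eq_value => // x Hx; rewrite tE.
Qed.

End FirstHomology.

(** * Kernels of characters on mapping tori *)

Section Windows.
Variables (G : groupType) (k : G) (D : set G).

Definition translate (n : int) (c : G) : G := zpow k n * c * (zpow k n)^-1.

(** The windows exhaust the kernel of a character of <k, D> that is 1 at k and
    vanishes on D; they play the role of the compact pieces of an infinite cyclic
    covering. *)
Definition window (m n : int) : set G :=
  generated [set translate j c | j in [set j | (m <= j <= n)%R] & c in D].

Lemma translateD i j c : translate i (translate j c) = translate (i + j)%R c.
Proof. by rewrite /translate zpowD invgM !mulgA. Qed.

Lemma translateM n : {morph translate n : x y / x * y}.
Proof. by move=> x y; rewrite /translate !mulgA mulgVK. Qed.

Lemma window_sub m n m' n' : (m' <= m)%R -> (n <= n')%R -> window m n `<=` window m' n'.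
Proof.
move=> mm nn; apply: generated_min; first exact: generated_subgroup.
move=> _ [j /= jmn] [c Dc <-]; apply: generated_sub; exists j => /=; first by lia.
by exists c.
Qed.

Lemma window_translate (i m n : int) x :
  window m n x -> window (m + i)%R (n + i)%R (translate i x).
Proof.
move: x; apply: generated_min.
  exact: (subgroup_preim (translateM i) (generated_subgroup _)).
move=> _ [j /= jmn] [c Dc <-]; apply: generated_sub; rewrite translateD.
by exists (i + j)%R => /=; [lia | exists c].
Qed.

Lemma windowM m n x y : window m n x -> window m n y -> window m n (x * y).
Proof. by have [_ + _] := generated_subgroup [set translate j c | j in [set j | (m <= j <= n)%R] & c in D]; apply. Qed.

Lemma windowV m n x : window m n x -> window m n x^-1.
Proof. by have [_ _] := generated_subgroup [set translate j c | j in [set j | (m <= j <= n)%R] & c in D]; apply. Qed.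

Lemma window1 m n : window m n 1.
Proof. by have [] := generated_subgroup [set translate j c | j in [set j | (m <= j <= n)%R] & c in D]. Qed.

(** The element f (k^m) k^-m is a product of translates of f(k) k^-1 or of its
    inverse by exponents between 0 and m, so it lies in a window that exceeds this
    segment by L only. *)
Lemma window_morph (f : G -> G) (L m : int) c :
  {morph f : x y / x * y} ->
  (forall c, D c -> window (- L)%R L (f c)) -> window (- L)%R L (f k * k^-1) ->
  D c ->
  window (Num.min 0 m - L)%R (Num.max 0 m + L)%R (f (translate m c)).
Proof.
move=> fM fD; set u := f k * k^-1 => wu Dc.
have fk : f k = u * k by rewrite mulgVK.
have step (n : int) : window (Num.min 0 n - L)%R (Num.max 0 n + L)%R
    (f (zpow k n) * (zpow k n)^-1).
  elim/int_ind: n => [|n IH|n IH].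
  - rewrite zpow0 (morph1 fM) invg1 mulg1; exact: window1.
  - have -> : f (zpow k n.+1) * (zpow k n.+1)^-1 =
              f (zpow k n) * (zpow k n)^-1 * translate n u.
      rewrite -addn1 PoszD !zpowS fM fk /translate invgM !mulgA mulgVK.
      by rewrite mulgVK.
    apply: windowM; first by apply: (window_sub _ _ IH); lia.
    by apply: (window_sub _ _ (window_translate (i := n) wu)); lia.
  - have E : zpow k (- n.+1%:Z)%R = zpow k (- n%:Z)%R * k^-1.
      by rewrite -[k^-1]/(zpow k (-1)%R) -zpowD; congr (zpow k _); lia.
    have -> : f (zpow k (- n.+1%:Z)%R) * (zpow k (- n.+1%:Z)%R)^-1 =
       f (zpow k (- n%:Z)%R) * (zpow k (- n%:Z)%R)^-1 * translate (- n.+1%:Z)%R u^-1.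
      rewrite /translate E fM (morphV fM) fk !invgM !invgK !mulgA.
      by rewrite !mulgVK.
    apply: windowM; first by apply: (window_sub _ _ IH); lia.
    by apply: (window_sub _ _ (window_translate (windowV wu))); lia.
have -> : f (translate m c) = f (zpow k m) * (zpow k m)^-1 * translate m (f c) *
    (f (zpow k m) * (zpow k m)^-1)^-1.
  by rewrite /translate !fM (morphV fM) invgM invgK !mulgA !mulgVK.
apply: windowM; last exact: windowV.
apply: windowM => //.
by apply: (window_sub _ _ (window_translate (i := m) (fD c Dc))); lia.
Qed.

(** Collecting the powers of k of a word on k and D at its right end turns its
    letters from D into translates. *)
Lemma window_kernel (a : G -> int) x :
  let K := generated (k |` D) in
  {in K &, forall x y, a (x * y) = (a x + a y)%R} -> a k = 1%R ->
  (forall c, D c -> a c = 0%R) -> K x ->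
  exists n : nat, window (- n%:Z)%R n (x * (zpow k (a x))^-1).
Proof.
move=> K aM ak aD; pose S := [set x | K x /\
  exists n : nat, window (- n%:Z)%R n (x * (zpow k (a x))^-1)].
have [K1 KM KV] := generated_subgroup (k |` D).
suff KS : K `<=` S by move=> /KS[].
have a1 : a 1 = 0%R.
  by apply: (addrI (a 1)); rewrite -aM ?mulg1 ?addr0 // inE.
have aV y : K y -> a y^-1 = (- a y)%R.
  by move=> Ky; apply/eqP; rewrite -addr_eq0 -aM ?mulVg ?a1 // inE //; exact: KV.
apply: generated_min.
  split=> [|y z [Ky [m my]] [Kz [n nz]]|y [Ky [m my]]].
  - split=> //; exists 0%N; rewrite a1 invg1 mulg1; exact: window1.
  - split; first exact: KM.
    exists (m + n + `|a y|)%N.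
    have -> : y * z * (zpow k (a (y * z)))^-1 =
        y * (zpow k (a y))^-1 * translate (a y) (z * (zpow k (a z))^-1).
      by rewrite aM ?inE // zpowD /translate invgM !mulgA mulgVK.
    apply: windowM; first by apply: (window_sub _ _ my); lia.
    by apply: (window_sub _ _ (window_translate (i := a y) nz)); lia.
  - split; first exact: KV.
    exists (m + `|a y|)%N.
    have -> : y^-1 * (zpow k (a y^-1))^-1 =
        translate (- a y)%R (y * (zpow k (a y))^-1)^-1.
      by rewrite aV // /translate zpowN !invgM !invgK !mulgA mulVg mul1g.
    by apply: (window_sub _ _ (window_translate (windowV my))); lia.
move=> y; case=> [->|Dy]; (split; first by apply: generated_sub; (left + right)).
  by exists 0%N; rewrite ak zpow1 mulgV; exact: window1.
exists 0%N; rewrite aD // invg1 mulg1; apply: generated_sub.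
by exists 0%R => //; exists y; rewrite // /translate mul1g invg1 mulg1.
Qed.

End Windows.

Lemma window_bound (G : groupType) (k : G) (D : set G) (s : seq G) :
  (forall x, x \in s -> exists n : nat, window k D (- n%:Z)%R n x) ->
  exists L : nat, forall x, x \in s -> window k D (- L%:Z)%R L x.
Proof.
elim: s => [|x s IH] sP; first by exists 0%N.
have [L LP] := IH (fun y ys => sP y (mem_behead (s := x :: s) ys)).
have [n xn] := sP x (mem_head _ _); exists (maxn L n) => y.
rewrite inE => /orP[/eqP ->|/LP yL]; first by apply: (window_sub _ _ xn); lia.
by apply: (window_sub _ _ yL); lia.
Qed.

(** Let t act on K = <k, D>, preserving the character a with a k = 1 that
    vanishes on D.  Conjugation by t moves the windows by a bounded amount L, so
    conjugation by k^-M t with M > L moves them in a definite direction; all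
    windows are then reached from a single one, and the kernel of the extension
    of a to <K, t> that takes the value M at t is finitely generated. *)
Lemma torus_kernel (G : groupType) (k t : G) (D : set G) (a : G -> int) :
  let K := generated (k |` D) in
  finite_set D -> {in K &, forall x y, a (x * y) = (a x + a y)%R} -> a k = 1%R ->
  (forall c, D c -> a c = 0%R) ->
  (forall x, K x -> K (t * x * t^-1) /\ a (t * x * t^-1) = a x) ->
  (forall x, K x -> K (t^-1 * x * t) /\ a (t^-1 * x * t) = a x) ->
  exists L : nat, forall M : int, (L%:Z < M)%R ->
    exists2 B : set G, finite_set B &
      B `<=` [set x | K x /\ a x = 0%R] /\
      forall x, K x -> a x = 0%R -> generated ((zpow k (- M)%R * t) |` B) x.
Proof.
move=> K finD aM ak aD tK t'K.
have [K1 KM KV] := generated_subgroup (k |` D).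
have Kk : K k by apply: generated_sub; left.
have KD c : D c -> K c by move=> Dc; apply: generated_sub; right.
have a1 : a 1 = 0%R by apply: (addrI (a 1)); rewrite -aM ?mulg1 ?addr0 // inE.
have aV y : K y -> a y^-1 = (- a y)%R.
  by move=> Ky; apply/eqP; rewrite -addr_eq0 -aM ?mulVg ?a1 // inE //; exact: KV.
have ker_window x : K x -> a x = 0%R -> exists n : nat, window k D (- n%:Z)%R n x.
  move=> Kx ax; have [n] := window_kernel aM ak aD Kx.
  by rewrite ax invg1 mulg1; exists n.
have /finite_seqP[s sE] := finD.
pose f x := t * x * t^-1; pose f' x := t^-1 * x * t.
have fM : {morph f : x y / x * y} by move=> x y; rewrite /f !mulgA mulgVK.
have f'M : {morph f' : x y / x * y} by move=> x y; rewrite /f' !mulgA mulgK.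
have [L LP] : exists L : nat, forall x,
    x \in [:: f k * k^-1, f' k * k^-1 & map f s ++ map f' s] -> window k D (- L%:Z)%R L x.
  apply: window_bound => x; rewrite !inE mem_cat => /or3P[/eqP ->|/eqP ->|/orP[]].
  - have [Kf af] := tK _ Kk; apply: ker_window; first by apply: (KM) => //; exact: KV.
    by rewrite aM ?inE ?aV ?af ?ak //; exact: KV.
  - have [Kf af] := t'K _ Kk; apply: ker_window; first by apply: (KM) => //; exact: KV.
    by rewrite aM ?inE ?aV ?af ?ak //; exact: KV.
  - move=> /mapP[c cs ->]; have Dc : D c by rewrite sE.
    by have [Kf af] := tK _ (KD _ Dc); apply: ker_window; rewrite // af aD.
  - move=> /mapP[c cs ->]; have Dc : D c by rewrite sE.
    by have [Kf af] := t'K _ (KD _ Dc); apply: ker_window; rewrite // af aD.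
have fD c : D c -> window k D (- L%:Z)%R L (f c).
  by move=> Dc; apply: LP; rewrite !inE mem_cat map_f ?orbT //; rewrite sE in Dc.
have f'D c : D c -> window k D (- L%:Z)%R L (f' c).
  by move=> Dc; apply: LP; rewrite !inE mem_cat (map_f f') ?orbT //; rewrite sE in Dc.
have fk : window k D (- L%:Z)%R L (f k * k^-1) by apply: LP; rewrite !inE eqxx.
have f'k : window k D (- L%:Z)%R L (f' k * k^-1) by apply: LP; rewrite !inE eqxx orbT.
exists L => M LM; pose R := (L + `|M|)%N.
pose B := [set translate k j c | j in [set j : int | (- R%:Z <= j <= R)%R] & c in D].
exists B.
  apply: finite_image2 => //.
  apply: (@sub_finite_set _ _ [set (j%:Z - R%:Z)%R | j in `I_(R + R).+1]); last first.
    exact: finite_image (finite_II _).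
  by move=> j /= jR; exists `|(j + R%:Z)%R|%N => /=; lia.
split.
  move=> _ [j /= _] [c Dc <-].
  have Kj : K (zpow k j) by exact: (subgroupZ _ (generated_subgroup _)).
  have Kjc : K (zpow k j * c) by apply: (KM) => //; exact: KD.
  have KVj : K (zpow k j)^-1 by exact: KV.
  split; first exact: KM.
  rewrite /translate aM ?inE // aM ?inE //; last exact: KD.
  by rewrite aV // (aD _ Dc) addr0 subrr.
set st := zpow k (- M)%R * t; set Y := generated _.
have [Y1 YM YV] := generated_subgroup (st |` B).
have Yst : Y st by apply: generated_sub; left.
have all_translates n : forall (m : int) c, (`|m| <= n)%N -> D c -> Y (translate k m c).
  elim/ltn_ind: n => n IH m c mn Dc.
  have winY i j : (- n%:Z < i)%R -> (j < n%:Z)%R -> window k D i j `<=` Y.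
    move=> ni jn; apply: generated_min; first exact: generated_subgroup.
    move=> _ [l /= lij] [d Dd <-]; apply: (IH `|l|%N) => //; lia.
  have [mR|Rm] := leqP `|m| R.
    apply: generated_sub; right; exists m => /=; first by lia.
    by exists c.
  have [m_ge0|m_lt0] := lerP 0 m.
  - have win := window_translate (i := (- M)%R) (window_morph (m := m) fM fD fk Dc).
    have -> : translate k m c = st^-1 * translate k (- M)%R (f (translate k m c)) * st.
      by rewrite /translate /f /st !invgM !mulgA !(mulgVK, mulgK, mulVg, mul1g).
    apply: (YM) => //; apply: (YM); first exact: YV.
    apply: winY win; lia.
  - have win := window_morph (m := (M + m)%R) f'M f'D f'k Dc.
    have -> : translate k m c = st * f' (translate k (M + m)%R c) * st^-1.
      rewrite -translateD /translate /f' /st !zpowN !invgM !invgK !mulgA.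
      by rewrite !(mulgVK, mulgK, mulVg, mul1g).
    apply: (YM); last exact: YV.
    apply: (YM) => //; apply: winY win; lia.
move=> x Kx ax; have [n] := ker_window x Kx ax.
apply: generated_min; first exact: generated_subgroup.
by move=> _ [j _] [c Dc <-]; apply: (all_translates `|j|%N).
Qed.

(** * The amalgam as a semidirect product with a free group *)

Section Semidirect.
Variables (N Q : groupType) (th : Q -> aut N).
Hypothesis thM : {morph th : x y / x * y}.

Definition semidirect of {morph th : x y / x * y} : Type := (N * Q)%type.
HB.instance Definition _ := Choice.on (semidirect thM).

Local Notation S := (semidirect thM).

Definition semi_mul (x y : S) : S := (x.1 * th x.2 y.1, x.2 * y.2).
Definition semi_one : S := (1, 1).
Definition semi_inv (x : S) : S := (th x.2^-1 x.1^-1, x.2^-1).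

Lemma th_mul x y n : th (x * y) n = th x (th y n).
Proof. by rewrite thM. Qed.

Lemma th_one n : th 1 n = n.
Proof. by rewrite (morph1 thM). Qed.

Lemma semi_mulA : associative semi_mul.
Proof. by move=> x y z; rewrite /semi_mul /= autM th_mul !mulgA. Qed.
Lemma semi_mul1 : left_id semi_one semi_mul.
Proof. by move=> [x m]; rewrite /semi_mul /= th_one !mul1g. Qed.
Lemma semi_mulr1 : right_id semi_one semi_mul.
Proof. by move=> [x m]; rewrite /semi_mul /= aut1 !mulg1. Qed.
Lemma semi_mulV : left_inverse semi_one semi_inv semi_mul.
Proof. by move=> [x m]; rewrite /semi_mul /= -autM !mulVg aut1. Qed.
Lemma semi_mulrV : right_inverse semi_one semi_inv semi_mul.
Proof. by move=> [x m]; rewrite /semi_mul /= -th_mul !mulgV th_one mulgV. Qed.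

HB.instance Definition _ := isGroup.Build (semidirect thM)
  semi_mulA semi_mul1 semi_mulr1 semi_mulV semi_mulrV.

Lemma semiM (x y : S) : x * y = (x.1 * th x.2 y.1, x.2 * y.2) :> S.
Proof. by []. Qed.

Lemma semiV (x : S) : x^-1 = (th x.2^-1 x.1^-1, x.2^-1) :> S.
Proof. by []. Qed.

Definition semi_inl (n : N) : S := (n, 1).
Definition semi_inr (q : Q) : S := (1, q).

Lemma semi_inlM : {morph semi_inl : x y / x * y}.
Proof. by move=> x y; rewrite semiM /= th_one mulg1. Qed.

Lemma semi_inrM : {morph semi_inr : x y / x * y}.
Proof. by move=> x y; rewrite semiM /= aut1 mulg1. Qed.

Lemma semi_sndM : {morph (fun x : S => x.2) : x y / x * y}.
Proof. by []. Qed.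

Lemma semi_split (x : S) : x = semi_inl x.1 * semi_inr x.2.
Proof. by case: x => n q; rewrite semiM /= th_one mulg1 mul1g. Qed.

Lemma semi_conj (x : S) n : x * semi_inl n * x^-1 = semi_inl (x.1 * th x.2 n * x.1^-1).
Proof. by rewrite !semiM semiV /= mulg1 -th_mul mulgV th_one. Qed.

End Semidirect.

Lemma virtually_algebraically_fibers_iso (G G' : groupType) (f : G -> G') (f' : G' -> G) :
  {morph f : x y / x * y} -> {morph f' : x y / x * y} -> cancel f f' -> cancel f' f ->
  virtually_algebraically_fibers G -> virtually_algebraically_fibers G'.
Proof.
move=> fM f'M fK f'K [H [sgH fiH [a [aM a_surj [S finS SE]]]]].
exists [set x | H (f' x)]; split; first exact: (subgroup_preim f'M sgH).
  exact: finite_index_preim.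
exists (a \o f'); split=> [x y Hx Hy|n|] /=.
- by rewrite f'M aM.
- by have [x Hx xn] := a_surj n; exists (f x); rewrite /= fK.
- exists (f @` S); first exact: finite_image.
  rewrite -generated_image // SE; apply/seteqP; split=> [_ [x Hx <-] /=|x Hx].
    by rewrite fK.
  by exists (f' x).
Qed.

Section AmalgamIso.
Variables (K : groupType) (u d : aut K).

Local Notation F := (free_group bool).

(** The surface group of the second factor serves as reference.  The identification
    by d of that of the first factor with it conjugates the monodromy u of the
    first factor. *)
Definition monodromy : F -> aut K :=
  free_lift (fun b : bool => if b then u else d * u * d^-1).

Lemma monodromyM : {morph monodromy : x y / x * y}.
Proof. exact: free_liftM. Qed.

Local Notation S := (semidirect monodromyM).
Local Notation Am := (amalgam (sd_inj u) (fun k => sd_inj u (d k))).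
Local Notation pr := (proj (amalgam_rel (sd_inj u) (fun k => sd_inj u (d k)))).
Let t b : F := free_gen b.

Let inB (x : semidirectZ u) : Am := pr (free_gen (inl x)).
Let inC (x : semidirectZ u) : Am := pr (free_gen (inr x)).

Let amalgam_eq x y : amalgam_rel (sd_inj u) (fun k => sd_inj u (d k)) (x^-1 * y) -> pr x = pr y.
Proof. by move=> rel; apply/projP; exact: sub_gen_smallest. Qed.

Let inBM : {morph inB : x y / x * y}.
Proof. by move=> x y; rewrite /inB -projM; apply: amalgam_eq; left; exists x, y. Qed.

Let inCM : {morph inC : x y / x * y}.
Proof. by move=> x y; rewrite /inC -projM; apply: amalgam_eq; right; left; exists x, y. Qed.

Let inB_inC k : inB (sd_inj u k) = inC (sd_inj u (d k)).
Proof. by apply: amalgam_eq; right; right; exists k. Qed.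

Let sdM (x y : semidirectZ u) : x * y = (x.1 * zpow u x.2 y.1, (x.2 + y.2)%R) :> semidirectZ u.
Proof. by []. Qed.

Let sd_split (x : semidirectZ u) : x = sd_inj u x.1 * zpow ((1, 1%R) : semidirectZ u) x.2.
Proof.
have zE n : zpow ((1, 1%R) : semidirectZ u) n = (1, n).
  elim/int_ind: n => [//|n IH|n IH].
  - by rewrite -addn1 PoszD zpowS IH sdM /= aut1 mulg1.
  - apply: (mulIg ((1, 1%R) : semidirectZ u)).
    have E : (- n.+1%:Z + 1)%R = (- n%:Z)%R by lia.
    by rewrite -zpowS E IH sdM -[RHS]/(1 * zpow u (- n.+1%:Z)%R 1, (- n.+1%:Z + 1)%R) aut1 mulg1 E.
by case: x => k n; rewrite zE sdM /= mulg1 add0r.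
Qed.

Let mono b n : zpow (monodromy (t b)) n = monodromy (zpow (t b) n).
Proof. by rewrite (morph_zpow monodromyM). Qed.

Let toB (x : semidirectZ u) : S := (d x.1, zpow (t false) x.2).
Let toC (x : semidirectZ u) : S := (x.1, zpow (t true) x.2).

Let toBM : {morph toB : x y / x * y}.
Proof.
move=> x y; rewrite /toB sdM semiM /= zpowD autM; congr (_ * _, _).
rewrite -mono /monodromy free_lift_gen zpow_conj.
by rewrite -[RHS]/(d (zpow u x.2 (aut_bwd d (d y.1)))) autK.
Qed.

Let toCM : {morph toC : x y / x * y}.
Proof.
move=> x y; rewrite /toC sdM semiM /= zpowD; congr (_ * _, _).
by rewrite -mono /monodromy free_lift_gen.
Qed.

Let to_free : free_group (semidirectZ u + semidirectZ u)%type -> S :=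
  free_lift (fun x => match x with inl x => toB x | inr x => toC x end).

Let ofK k := inC (sd_inj u k).
Let ofF : F -> Am := free_lift (fun b : bool =>
  if b then inC (1, 1%R) else inB (1, 1%R)).

Let ofKM : {morph ofK : x y / x * y}.
Proof.
by move=> x y; rewrite /ofK -inCM sdM /= addr0.
Qed.

Let of_conj w k : ofF w * ofK k * (ofF w)^-1 = ofK (monodromy w k).
Proof.
have ofFM : {morph ofF : x y / x * y} by exact: free_liftM.
move: w k; apply: free_group_ind.
  split=> [k|x y Hx Hy k|x Hx k] /=.
  - by rewrite (morph1 ofFM) (morph1 monodromyM) mul1g invg1 mulg1.
  - by rewrite ofFM invgM monodromyM !mulgA -2!(mulgA (ofF x)) Hy Hx.
  - have := Hx (monodromy x^-1 k); rewrite -(@th_mul _ _ _ monodromyM) mulgV.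
    rewrite (th_one monodromyM) => <-.
    by rewrite (morphV ofFM) invgK !mulgA mulVg mul1g mulgVK.
have sd_conj (k : K) : ((1, 1%R) : semidirectZ u) * sd_inj u k = sd_inj u (u k) * (1, 1%R).
  by rewrite !sdM /= mul1g mulg1.
case=> k; rewrite /ofF /monodromy !free_lift_gen.
  by rewrite -inCM sd_conj inCM mulgK.
rewrite /ofK -{1}(autVK d k) -inB_inC -inBM sd_conj inBM mulgK inB_inC.
by [].
Qed.

Let of_S (x : S) : Am := ofK x.1 * ofF x.2.

Let of_SM : {morph of_S : x y / x * y}.
Proof.
move=> x y; rewrite /of_S semiM /= ofKM -of_conj.
by rewrite /ofF free_liftM !mulgA mulgVK.
Qed.

(** Both groups are generated by K and the two stable letters, with the same
    action of the letters on K, and the maps given by the two presentations are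
    inverse to each other on these generators. *)
Lemma amalgam_iso : exists (f : Am -> S) (f' : S -> Am),
  [/\ {morph f : x y / x * y}, {morph f' : x y / x * y}, cancel f f' & cancel f' f].
Proof.
have to_freeM : {morph to_free : x y / x * y} by exact: free_liftM.
have to_free_gen x : to_free (free_gen x) = match x with inl x => toB x | inr x => toC x end.
  exact: free_lift_gen.
have to_rel x : amalgam_rel (sd_inj u) (fun k => sd_inj u (d k)) x -> to_free x = 1.
  case=> [[y [z ->]]|[[y [z ->]]|[k ->]]];
    rewrite !to_freeM (morphV to_freeM) ?to_freeM !to_free_gen.
  - by rewrite toBM mulVg.
  - by rewrite toCM mulVg.
  - by rewrite /toB /toC /= mulVg.
have [f fM fE] := quot_lift to_freeM to_rel.
exists f, of_S; split=> // [|x].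
- have fofM : {morph (of_S \o f \o pr) : x y / x * y}.
    by move=> x y; rewrite /= projM fM of_SM.
  have E : of_S \o f \o pr =1 pr.
    apply: free_morph_eq fofM (projM _) _ => -[x|x] /=.
    + rewrite fE to_free_gen /of_S /= -/(inB x) [in RHS](sd_split x) inBM inB_inC.
      congr (_ * _); rewrite (morph_zpow inBM) /ofF.
      by rewrite (morph_zpow (free_liftM _)) free_lift_gen.
    + rewrite fE to_free_gen /of_S /= -/(inC x) [in RHS](sd_split x) inCM.
      congr (_ * _); rewrite (morph_zpow inCM) /ofF.
      by rewrite (morph_zpow (free_liftM _)) free_lift_gen.
  by move=> q; have [x <-] := proj_surj q; exact: E.
- rewrite [RHS]semi_split /of_S fM; congr (_ * _).
  + by rewrite /ofK /inC fE to_free_gen.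
  + have fF : {morph (f \o ofF) : x y / x * y}.
      by move=> y z; rewrite /= /ofF free_liftM fM.
    apply: (free_morph_eq fF (semi_inrM monodromyM)) => -[];
      by rewrite /= /ofF free_lift_gen fE to_free_gen /toB /toC /= ?aut1.
Qed.

End AmalgamIso.

(** * The mapping class group and the monodromy *)

Section OuterMonodromy.
Variables (g : nat) (u d : aut (surface_group g)).
Hypothesis generate : generated [set out u; out (d * u * d^-1)] = Mod g.

Local Notation K := (surface_group g).
Local Notation th := (monodromy u d).

Lemma inner_normal (G : groupType) : normal_subgroup (@inner G).
Proof.
split; first split.
- by exists 1 => x; rewrite invg1 mulg1 mul1g.
- move=> a b [k ak] [l bl]; exists (k * l) => x.
  by rewrite -[LHS]/(a (b x)) bl ak invgM !mulgA.
- move=> a [k ak]; exists k^-1 => x.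
  by rewrite -[LHS]/(aut_bwd a x) invgK -[RHS](autK a) ak !mulgA mulgV mul1g mulgK.
- move=> a b [k ak]; exists (aut_bwd b k) => x.
  rewrite -[LHS]/(aut_bwd b (a (b x))) ak !aut_bwdM autK.
  by rewrite (morphV (@aut_bwdM _ b)).
Qed.

Lemma out_eq (G : groupType) (a b : aut G) :
  out a = out b -> exists k, forall x, b x = a (k * x * k^-1).
Proof.
move=> /projP ab; have [k kE] : inner (a^-1 * b).
  by apply: (@smallest_sub _ _ (@inner G) (@inner G)) ab => //; exact: inner_normal.
by exists k => x; rewrite -kE -[a^-1 * b]/(aut_mul (aut_inv a) b) /= autVK.
Qed.

Let outM : {morph @out K : x y / x * y}.
Proof. exact: projM. Qed.

(** The classes of the automorphisms th w form a subgroup of Out K that contains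
    the two generators of the mapping class group. *)
Lemma Mod1_monodromy f : Mod1 g f ->
  exists k w, forall x, f x = k * th w x * k^-1.
Proof.
move=> f1; have : Mod g (out f) by exists f.
rewrite -generate => fgen.
have [w wE] : exists w, out (th w) = out f.
  suff : generated [set out u; out (d * u * d^-1)] `<=` range (@out K \o th).
    by move=> /(_ _ fgen)[w _ <-]; exists w.
  apply: generated_min.
    apply: (subgroup_image (f := @out K \o th)) => //.
    by move=> x y /=; rewrite monodromyM outM.
  move=> _ [->|->].
    by exists (free_gen true) => //=; rewrite /monodromy free_lift_gen.
  by exists (free_gen false) => //=; rewrite /monodromy free_lift_gen.
have [k kE] := out_eq wE; exists (th w k), w => x.
by rewrite kE !autM (morphV (@autM _ (th w))).
Qed.

Lemma monodromy_Mod1 w : exists2 f, Mod1 g f & exists k, forall x, th w x = f (k * x * k^-1).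
Proof.
have : Mod g (out (th w)).
  rewrite -generate; move: w; apply: free_group_ind.
    apply: (subgroup_preim (f := @out K \o th)); last exact: generated_subgroup.
    by move=> x y /=; rewrite monodromyM outM.
  by case; apply: generated_sub; rewrite /monodromy free_lift_gen; [left | right].
by move=> [f f1 /out_eq[k kE]]; exists f => //; exists k.
Qed.

End OuterMonodromy.

(** * The intersection form on a characteristic subgroup *)

Section CharacteristicForm.
Variables (g : nat) (H : set (surface_group g)).
Hypotheses (sgH : subgroup H) (fiH : finite_index H) (chH : characteristic H).
Local Open Scope ring_scope.

Local Notation K := (surface_group g).
Local Notation hom := (hom_on H).

Lemma characteristic_aut (f : aut K) x : H (f x) <-> H x.
Proof.
split=> [Hfx|Hx]; last by rewrite -(chH f); exists x.
by move: Hfx; rewrite -{1}(chH f) => -[y Hy] /(can_inj (autK f)) <-.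
Qed.

Lemma characteristic_conj k x : H x -> H (k * x * k^-1)%g.
Proof.
have cM : {morph (fun y : K => k * y * k^-1) : x y / x * y}%g.
  by move=> a b; rewrite !mulgA mulgVK.
have cK : cancel (fun y : K => k * y * k^-1)%g (fun y => k^-1 * y * k)%g.
  by move=> a; rewrite !mulgA mulVg mul1g mulgVK.
have cVK : cancel (fun y : K => k^-1 * y * k)%g (fun y => k * y * k^-1)%g.
  by move=> a; rewrite !mulgA mulgV mul1g mulgK.
exact: (characteristic_aut (Aut cM cK cVK) x).2.
Qed.

(** The intersection form of the covering surface with group H, carried over to
    the homomorphisms on H by their equivariant extensions.  It does not depend
    on the choice of these, which makes it invariant under mapping classes. *)
Lemma characteristic_form : exists w : (K -> rat) -> (K -> rat) -> rat,
  [/\ forall k a a' b, hom a -> hom a' -> hom b ->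
        w (fun x => k * a x + a' x) b = k * w a b + w a' b,
      forall k a b b', hom a -> hom b -> hom b' ->
        w a (fun x => k * b x + b' x) = k * w a b + w a b',
      forall a a' b b', hom a -> hom a' -> hom b -> hom b' ->
        (forall x, H x -> a x = a' x) -> (forall x, H x -> b x = b' x) ->
        w a b = w a' b' &
      [/\ forall a, hom a -> (forall b, hom b -> w a b = 0) -> forall x, H x -> a x = 0,
          forall a b, hom a -> hom b -> w a b = - w b a &
          forall (f : aut K) a b, Mod1 g f -> hom a -> hom b ->
            w (a \o f) (b \o f) = w a b]].
Proof.
have [n [cls [rep [repK clsE]]]] := finite_indexP sgH fiH.
pose ext a x := extend cls rep a x - extend cls rep a 1%g.
have ext_e a : hom a -> equivariant H (ext a) by exact: extend_equivariant.
have extH a x : hom a -> H x -> ext a x = a x by exact: extend_hom.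
have cycle := fundamental_cycleP g.
exists (fun a b => intersection rep (fundamental_cycle g) (ext a) (ext b)).
have ext_lin k a b : ext (fun x => k * a x + b x) = fun x => k * ext a x + ext b x.
  by apply/funext => x; rewrite /ext /extend; ring.
have homf (f : aut K) a : hom a -> hom (a \o f).
  by move=> am x y Hx Hy /=; rewrite autM am //; apply/characteristic_aut.
split=> [k a a' b am a'm bm|k a b b' am bm b'm|a a' b b' am a'm bm b'm aa' bb'|].
- by rewrite ext_lin intersection_linl.
- by rewrite ext_lin intersection_linr.
- apply: (intersection_restrict repK clsE cycle); try exact: ext_e.
    by move=> x Hx; rewrite !extH ?aa'.
  by move=> x Hx; rewrite !extH ?bb'.
split=> [a am a0 x Hx|a b am bm|f a b f1 am bm].
- rewrite -(extH a) //.
  apply: (intersection_nondegenerate sgH repK clsE (ext_e _ am)) => // B Be.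
  have Bm := equivariant_hom_on Be; rewrite -(a0 B Bm).
  apply: (intersection_restrict repK clsE cycle) => //; try exact: ext_e.
  by move=> y Hy; rewrite extH.
- exact: (intersection_anti repK clsE cycle (ext_e _ am) (ext_e _ bm)).
- rewrite -(intersection_aut repK clsE cycle (characteristic_aut f) f1 (ext_e _ am) (ext_e _ bm)).
  have fe a' : hom a' -> equivariant H (ext a' \o f).
    by move=> a'm h x Hh /=; rewrite autM ext_e //; apply/characteristic_aut.
  apply: (intersection_restrict repK clsE cycle); try (by apply: ext_e; apply: homf);
    try exact: fe.
    by move=> x Hx; rewrite extH //=; [rewrite extH //; apply/characteristic_aut | exact: homf].
  by move=> x Hx; rewrite extH //=; [rewrite extH //; apply/characteristic_aut | exact: homf].
Qed.

End CharacteristicForm.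

(** * Translates of homology classes *)

Section Orbits.
Variables (g : nat) (H : set (surface_group g)).
Hypotheses (sgH : subgroup H) (fiH : finite_index H) (chH : characteristic H).
Local Open Scope ring_scope.

Local Notation K := (surface_group g).
Local Notation hom := (hom_on H).
Local Notation chain := {freeg K / rat}.

Lemma subgroup_generators : exists r (s : 'I_r -> K), generated (range s) = H.
Proof.
have /finitely_generatedP[s sH] := finite_index_fg (@surface_group_fg g) sgH fiH.
exists (size s), (fun i => s`_i)%g; rewrite -sH; congr generated.
apply/seteqP; split=> [_ [i _ <-]|x /= xs] /=; first exact: mem_nth.
have xi : (index x s < size s)%N by rewrite index_mem.
by exists (Ordinal xi); rewrite //= nth_index.
Qed.

Lemma boundaryP c : C1 H c -> (forall a, hom a -> value a c = 0) -> B1 H c.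
Proof. by have [r [s sH]] := subgroup_generators; exact: (B1P sgH sH). Qed.

Lemma hom_aut (f : aut K) a : hom a -> hom (a \o f).
Proof. by move=> am x y Hx Hy /=; rewrite autM am //; apply/characteristic_aut. Qed.

Lemma C1_chain1_map (f : aut K) c : C1 H c -> C1 H (chain1_map f c : chain).
Proof.
move=> Hc; rewrite /chain1_map (fglift_dom (fun x => << f x >>)).
rewrite big_seq => x /dom_sum_subset /flatten_mapP[y].
rewrite mem_filter => /andP[yc _] /domZ_subset; rewrite domU1 inE => /eqP ->.
by apply/characteristic_aut => //; exact: Hc.
Qed.

Lemma chain1_mapK (f f' : K -> K) : cancel f' f ->
  cancel (chain1_map f' : chain -> chain) (chain1_map f).
Proof.
move=> fK c; rewrite /chain1_map fglift_comp -[RHS]freeg_sumE fglift_dom.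
apply: eq_bigr => x _; rewrite fgliftU fK.
by apply/eqP/freeg_eqP => y; rewrite coeffZ !coeffU mul1r.
Qed.

(** Through the intersection form w, the translate of a class by a mapping class
    f is determined by the translate of the dual homomorphism. *)
Lemma H1_act_dual (w : (K -> rat) -> (K -> rat) -> rat) b c (f : aut K) :
  (forall (f : aut K) a b, Mod1 g f -> hom a -> hom b -> w (a \o f) (b \o f) = w a b) ->
  hom b -> C1 H c -> (forall a, hom a -> w a b = value a c) -> Mod1 g f ->
  H1_act f (H1_class H c) =
    [set e | C1 H e /\ forall a, hom a -> w a (b \o aut_bwd f) = value a e].
Proof.
move=> w_inv bm Hc bc f1.
have bfm : hom (b \o aut_bwd f) by exact: (hom_aut (aut_inv f)).
have wf a : hom a -> w a (b \o aut_bwd f) = w (a \o f) b.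
  move=> am; rewrite -(w_inv f) //; congr (w _ _).
  by apply/funext => x /=; rewrite autK.
apply/seteqP; split=> [_ [e [He Be] <-]|e [He eb]].
  split=> [|a am]; first exact: C1_chain1_map.
  have afm := hom_aut f am.
  rewrite wf // bc // value_chain1_map; apply/esym/eqP; rewrite -subr_eq0 -valueB.
  by rewrite (value_B1 afm Be).
exists (chain1_map (aut_bwd f) e); last by rewrite (chain1_mapK (autVK f)).
have Hfe : C1 H (chain1_map (aut_bwd f) e : chain) by exact: (C1_chain1_map (f := aut_inv f)).
split=> //; apply: boundaryP => [|a am].
  by rewrite -scaleN1r addrC; exact: C1_lin.
have am' : hom (a \o aut_bwd f) by exact: (hom_aut (aut_inv f)).
rewrite valueB value_chain1_map -eb // wf // -bc //.
have -> : (a \o aut_bwd f) \o f = a by apply/funext => x /=; rewrite autK.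
by rewrite subrr.
Qed.

Lemma H1_class_eq0 c : C1 H c -> B1 H c -> H1_class H c = H1_class H (0 : chain).
Proof.
move=> Hc Bc; apply/seteqP; split=> e [He Be]; split=> //.
  by rewrite subr0 -(subrK c e); exact: B1_D.
by rewrite subr0 in Be; apply: B1_D => //; exact: B1_N.
Qed.

End Orbits.

(** * Characters, stabilizers and virtual fiberings *)

(** A nonzero rational character of a finitely generated group is a rational
    multiple of a surjective integral one: its values have a common denominator,
    and they are the multiples of the least positive one. *)
Lemma integral_character (G : groupType) (H : set G) r (s : 'I_r -> G) (b : G -> rat) :
  subgroup H -> generated (range s) = H -> hom_on H b -> ~ (forall x, H x -> b x = 0%R) ->
  exists (a : G -> int) (q : rat), q != 0%R /\ (exists2 x, H x & a x = 1%R) /\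
    forall x, H x -> b x = (q * (a x)%:~R)%R.
Proof.
move=> sgH sH bm b0; have [H1 HM HV] := sgH.
have [D D_gt0 DH] : exists2 D : nat, (0 < D)%N &
    forall x, H x -> exists z : int, (D%:R * b x = z%:~R)%R.
  have [D D_gt0 Ds] : exists2 D : nat, (0 < D)%N &
      forall i, i \in index_enum 'I_r -> exists z : int, (D%:R * b (s i) = z%:~R)%R.
    elim: (index_enum 'I_r) => [|i l [D D_gt0 Dl]]; first by exists 1%N.
    have den_gt0 : (0 < `|denq (b (s i))|)%N by rewrite absz_gt0 denq_neq0.
    exists (D * `|denq (b (s i))|)%N; first by rewrite muln_gt0 D_gt0.
    move=> j; rewrite inE => /orP[/eqP ->|/Dl[z zE]].
      exists (D%:Z * numq (b (s i)))%R.
      rewrite natrM -mulrA intrM; congr (_ * _)%R.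
      rewrite numqE mulrC; congr (_ * _)%R.
      by rewrite -[in RHS](gtz0_abs (denq_gt0 _)).
    exists (`|denq (b (s i))|%N%:Z * z)%R.
    by rewrite natrM intrM -zE mulrAC mulrC.
  exists D => // x Hx.
  suff : H `<=` [set x | H x /\ exists z : int, (D%:R * b x = z%:~R)%R] by move=> /(_ x Hx)[].
  rewrite -{1}sH; apply: generated_min; last first.
    move=> _ [i _ <-]; split; first by rewrite -sH; apply: generated_sub; exists i.
    exact: Ds (mem_index_enum i).
  split=> [|y z [Hy [m ym]] [Hz [n zn]]|y [Hy [m ym]]].
  - by split=> //; exists 0%R; rewrite (hom_on1 sgH bm) mulr0.
  - by split; [exact: HM | exists (m + n)%R; rewrite bm // mulrDr ym zn intrD].
  - by split; [exact: HV | exists (- m)%R; rewrite (hom_onV sgH bm Hy) mulrN ym intrN].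
have D0 : (D%:R : rat) != 0%R by rewrite pnatr_eq0 -lt0n.
pose P n := (0 < n)%N && `[< exists2 x, H x & (D%:R * b x = n%:R :> rat)%R >].
have exP : exists n, P n.
  have [x Hx bx] : exists2 x, H x & b x <> 0%R.
    by apply: contrapT => nb; apply: b0 => x Hx; apply: contrapT => bx; apply: nb; exists x.
  have [z zE] := DH x Hx; exists `|z|%N; apply/andP; split.
    rewrite absz_gt0; apply/eqP => z0; apply: bx; move/eqP: zE.
    by rewrite z0 mulf_eq0 (negPf D0) => /eqP.
  apply/asboolP; have [z_ge0|z_lt0] := lerP 0%R z.
    by exists x; rewrite // zE -[in LHS](gez0_abs z_ge0).
  exists x^-1; first exact: HV.
  rewrite (hom_onV sgH bm Hx) mulrN zE -intrN.
  by rewrite -(ltz0_abs z_lt0).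
case: (ex_minnP exP) => m /andP[m_gt0 /asboolP[k Hk km]] m_min.
have bX n : b (k ^+ n) = (b k *+ n)%R.
  elim: n => [|n IH]; first by rewrite (hom_on1 sgH bm) mulr0n.
  by rewrite expgS bm ?IH ?mulrS //; exact: subgroupX.
have bZ n : b (zpow k n) = (b k * n%:~R)%R.
  case: n => n /=; first by rewrite bX [RHS]mulr_natr.
  rewrite (hom_onV sgH bm); last exact: subgroupX.
  by rewrite bX NegzE intrN mulrN; congr (- _)%R; rewrite [RHS]mulr_natr.
have multiple x : H x -> exists z : int, b x = (b k * z%:~R)%R.
  move=> Hx; have [z zE] := DH x Hx; exists (z %/ m%:Z)%Z.
  pose y := x * (zpow k (z %/ m%:Z)%Z)^-1.
  have Hz : H (zpow k (z %/ m%:Z)%Z) by exact: subgroupZ.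
  have Hy : H y by apply: (HM) => //; exact: HV.
  have yE : (D%:R * b y = (z %% m%:Z)%Z%:~R)%R.
    rewrite bm //; last exact: HV.
    rewrite (hom_onV sgH bm Hz) bZ mulrDr zE mulrN mulrA km {1}(divz_eq z m%:Z).
    by rewrite intrD intrM; ring.
  have m0 : (m%:Z != 0)%R by lia.
  have r_lt : (`|(z %% m%:Z)%Z| < m)%N by rewrite -ltz_nat gez0_abs ?modz_ge0 // ltz_pmod.
  have r0 : `|(z %% m%:Z)%Z|%N = 0%N.
    apply/eqP; rewrite -leqn0 leqNgt; apply/negP => r_gt0.
    have : P `|(z %% m%:Z)%Z|%N.
      rewrite /P r_gt0; apply/asboolP; exists y => //.
      by rewrite yE -[in LHS](gez0_abs (modz_ge0 z m0)).
    by move=> /m_min; rewrite leqNgt r_lt.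
  have by0 : b y = 0%R.
    move/eqP: yE; rewrite (_ : (z %% m%:Z)%Z = 0%R); last by apply/eqP; rewrite -absz_eq0 r0.
    by rewrite mulf_eq0 (negPf D0) => /eqP.
  by rewrite -bZ -[x](mulgVK (zpow k (z %/ m%:Z)%Z)) bm // -/y by0 add0r.
have bk0 : b k != 0%R.
  apply/eqP => bk; move/eqP: km; rewrite bk mulr0 eq_sym pnatr_eq0 => /eqP m0.
  by rewrite m0 in m_gt0.
pose a x := xget 0%R [set z : int | b x = (b k * z%:~R)%R].
have aE x : H x -> b x = (b k * (a x)%:~R)%R.
  by move=> /multiple[z zE]; rewrite /a; case: xgetP => // /(_ z).
exists a, (b k); split=> //; split=> //; exists k => //.
apply: (@intr_inj rat); apply: (mulfI bk0).
by rewrite -aE // mulr1.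
Qed.

Section Fibering.
Variables (g : nat) (u d : aut (surface_group g)).
Hypothesis generate : generated [set out u; out (d * u * d^-1)] = Mod g.

Local Notation K := (surface_group g).
Local Notation F := (free_group bool).
Local Notation th := (monodromy u d).
Local Notation S := (semidirect (monodromyM u d)).
Local Notation inl_ := (semi_inl (monodromyM u d)).
Local Notation inr_ := (semi_inr (monodromyM u d)).

(** A fibering of a finite index subgroup that is trivial on the surface group
    would fiber a finite index subgroup of the free group. *)
Lemma fibering_nontrivial (H : set S) (f : S -> int) :
  subgroup H -> finite_index H ->
  (forall x y, H x -> H y -> f (x * y) = (f x + f y)%R) ->
  (forall n : int, exists2 x, H x & f x = n) ->
  finitely_generated [set x | H x /\ f x = 0%R] ->
  exists2 k, H (inl_ k) & f (inl_ k) <> 0%R.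
Proof.
move=> sgH fiH fM f_surj [T finT TE]; apply: contrapT => f0.
have [H1 HM HV] := sgH.
have {}f0 k : H (inl_ k) -> f (inl_ k) = 0%R.
  by move=> Hk; apply: contrapT => fk; apply: f0; exists k.
have f_snd x y : H x -> H y -> x.2 = y.2 -> f x = f y.
  move=> Hx Hy xy; have Hxy : H (x * y^-1) by apply: HM => //; exact: HV.
  have xyE : x * y^-1 = inl_ (x * y^-1).1.
    have xy1 : (x * y^-1).2 = 1 by rewrite semiM semiV /= xy mulgV.
    by rewrite [LHS]semi_split xy1 (morph1 (semi_inrM _)) mulg1.
  have fxy : f (x * y^-1) = 0%R by rewrite xyE; apply: f0; rewrite -xyE.
  by rewrite -[x](mulgVK y) fM // fxy add0r.
pose H2 := (fun x : S => x.2) @` H.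
pose a w := f (xget 1 [set x | H x /\ x.2 = w]).
have aE x : H x -> a x.2 = f x.
  move=> Hx; rewrite /a; case: xgetP => [y _ [Hy yx]|/(_ x)[]//].
  exact: f_snd.
have sgH2 : subgroup H2 by exact: (subgroup_image (@semi_sndM _ _ _ _) sgH).
apply: (@free_not_fibering bool H2); first exact: sgH2.
- have [n [cls [_ [_ clsE]]]] := finite_indexP sgH fiH.
  apply: (@finite_index_of _ _ (fun w => cls (inr_ w))) => // x y /clsE.
  by move=> Hxy; exists (inr_ x * (inr_ y)^-1).
- by rewrite card_bool.
exists a; split.
- move=> _ _ [x Hx <-] [y Hy <-]; transitivity (f (x * y)).
    exact: (aE _ (HM _ _ Hx Hy)).
  by rewrite fM // !aE.
- by move=> n; have [x Hx fx] := f_surj n; exists x.2; [exists x | rewrite aE].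
- exists ((fun x : S => x.2) @` T); first exact: finite_image.
  rewrite -(generated_image (@semi_sndM _ _ _ _)) TE; apply/seteqP; split.
    by move=> _ [x [Hx fx] <-]; split; [exists x | rewrite aE].
  by move=> _ [[x Hx <-]]; rewrite aE // => fx; exists x.
Qed.

(** The restriction b of a fibering f to a characteristic subgroup H of K is
    invariant under conjugation by the domain of f, so its translates are indexed
    by the cosets of that domain.  The class dual to b then violates NFO. *)
Lemma fibering_not_NFO : virtually_algebraically_fibers S -> ~ NFO g.
Proof.
move=> [HS [sgHS fiHS [f [fM f_surj fgker]]]] nfo.
have [k0 Hk0 fk0] := fibering_nontrivial sgHS fiHS fM f_surj fgker.
have [HS1 HSM HSV] := sgHS.
have inlM := semi_inlM (monodromyM u d).
have [H [sgH fiH chH subH]] := characteristic_core (@surface_group_fg g)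
  (subgroup_preim inlM sgHS) (finite_index_preim inlM sgHS fiHS).
pose b k : rat := ((f (inl_ k))%:~R)%R.
have bm : hom_on H b.
  by move=> x y /subH Hx /subH Hy; rewrite /b inlM fM // intrD.
have [w [wl wr w_eq [w_nd w_anti w_inv]]] := characteristic_form sgH fiH chH.
have [r [s sH]] := subgroup_generators sgH fiH.
have [c Hc bc] : exists2 c : {freeg K / rat}, C1 H c &
    forall a, hom_on H a -> (- w b a)%R = value a c.
  apply: (hom_functional_chain sgH sH) => [k a a' am a'm|a a' am a'm aa'].
    by rewrite wr //; ring.
  by rewrite (w_eq _ b _ a').
have {}bc a : hom_on H a -> w a b = value a c by move=> am; rewrite w_anti // bc.
apply: (nfo H sgH fiH chH (H1_class H c)).
- by exists c.
- move=> c0.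
  have [n n_gt0 Hn] := finite_index_power k0 sgH fiH.
  have : H1_class H c c.
    by split=> //; rewrite subrr; exact: B1_0.
  rewrite c0 => -[_]; rewrite subr0 => Bc.
  have bn0 : b (k0 ^+ n) = 0%R.
    apply: (w_nd b bm) => // a am.
    by rewrite w_anti // bc // (value_B1 am Bc) oppr0.
  have fX m : f (inl_ (k0 ^+ m)) = (f (inl_ k0) *+ m)%R.
    elim: m => [|m IH].
      rewrite (morph1 inlM) mulr0n; apply: (addrI (f 1)).
      by rewrite -fM // mulg1 addr0.
    rewrite expgS inlM fM ?IH ?mulrS // (morphX inlM).
    exact: subgroupX.
  move: bn0; rewrite /b fX => /eqP; rewrite intr_eq0 mulrn_eq0 => /orP[/eqP n0|/eqP//].
  by rewrite n0 in n_gt0.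
- (* The translates of b factor through the finite set of cosets. *)
  have [n [cls [rep [repK clsE]]]] := finite_indexP sgHS fiHS.
  pose Phi i := [set e : {freeg K / rat} | C1 H e /\ forall a, hom_on H a ->
    w a (fun x => (f (rep i * inl_ x * (rep i)^-1)%g)%:~R%R) = value a e].
  apply: (@sub_finite_set _ _ (range Phi)); last exact: finite_image finite_finset.
  move=> _ [phi phi1 <-].
  rewrite (H1_act_dual sgH fiH chH w_inv bm Hc bc phi1).
  have [k [v phiE]] := Mod1_monodromy generate phi1.
  pose y : S := (k, v); exists (cls y^-1) => //.
  set i := cls _.
  have Hcls : HS (rep i * y) by have : cls (rep i) = cls y^-1 by [rewrite repK];
    move=> /clsE; rewrite invgK.
  have bE x : H x -> (b \o aut_bwd phi) x = (f (rep i * inl_ x * (rep i)^-1)%g)%:~R%R.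
    move=> Hx; congr (_%:~R)%R; set x' := aut_bwd phi x.
    have Hx' : HS (inl_ x').
      by apply: subH; apply/(characteristic_aut chH phi); rewrite /x' autVK.
    have -> : rep i * inl_ x * (rep i)^-1 = (rep i * y) * inl_ x' * (rep i * y)^-1.
      have -> : inl_ x = y * inl_ x' * y^-1.
        by rewrite semi_conj /= -phiE autVK.
      by rewrite invgM !mulgA.
    have HVcls : HS (rep i * y)^-1 by exact: HSV.
    move: (rep i * y) Hcls HVcls => q Hq HVq.
    rewrite fM ?fM //; last exact: HSM.
    have : (f q + f q^-1%g = 0)%R.
      rewrite -fM // mulgV; apply: (addrI (f 1)).
      by rewrite -fM // mulg1 addr0.
    by move=> E; lia.
  have bm' : hom_on H (b \o aut_bwd phi) by exact: (hom_aut chH (aut_inv phi)).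
  have bm'' : hom_on H (fun x => (f (rep i * inl_ x * (rep i)^-1)%g)%:~R%R).
    have [_ HM _] := sgH.
    by move=> x z Hx Hz; rewrite -!bE // ?bm' //; exact: HM.
  apply/seteqP; split=> e [He eb]; split=> // a am.
    by rewrite -eb //; apply: w_eq => // x Hx; rewrite bE.
  by rewrite -eb //; apply: w_eq => // x Hx; rewrite bE.
Qed.

(** Duality turns the finite orbit of the class of c under mapping classes into a
    finite orbit of b.  Inner automorphisms enlarge it by a finite factor only,
    since b is invariant under conjugation by H. *)
Lemma stabilizer_finite_index (H : set K) (b : K -> rat) c w :
  subgroup H -> finite_index H -> characteristic H ->
  (forall a, hom_on H a -> (forall b, hom_on H b -> w a b = 0%R) -> forall x, H x -> a x = 0%R) ->
  (forall a b, hom_on H a -> hom_on H b -> w a b = - w b a)%R ->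
  (forall k a b b', hom_on H a -> hom_on H b -> hom_on H b' ->
    w a (fun x => k * b x + b' x) = k * w a b + w a b')%R ->
  (forall (f : aut K) a b, Mod1 g f -> hom_on H a -> hom_on H b ->
    w (a \o f) (b \o f) = w a b) ->
  hom_on H b -> C1 H c -> (forall a, hom_on H a -> w a b = value a c) ->
  finite_set [set H1_act f (H1_class H c) | f in Mod1 g] ->
  let St := [set v | forall x, H x -> b (th v x) = b x] in
  subgroup St /\ finite_index St.
Proof.
move=> sgH fiH chH w_nd w_anti wr w_inv bm Hc bc /finite_seqP[s sE] St.
have [H1 HM HV] := sgH.
have Hth v x : H x -> H (th v x) by move=> Hx; apply/(characteristic_aut chH).
have thM := monodromyM u d.
have sgSt : subgroup St.
  split=> [x Hx|v v' Sv Sv' x Hx|v Sv x Hx] /=.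
  - by rewrite (th_one thM).
  - by rewrite (th_mul thM) Sv ?Sv' //; exact: Hth.
  - by rewrite -(Sv (th v^-1 x)) -?(th_mul thM) ?mulgV ?(th_one thM) //; exact: Hth.
split=> //.
have [n [cls [rep [repK clsE]]]] := finite_indexP sgH fiH.
(* th v^-1 is a mapping class f up to an inner automorphism by l, so b o th v
   depends only on the translate of the class by f and on the coset of l. *)
have /choice[fl flP] : forall v, exists fl : aut K * K, Mod1 g fl.1 /\
    forall x, th v^-1 x = fl.1 (fl.2 * x * fl.2^-1).
  by move=> v; have [f f1 [l fE]] := monodromy_Mod1 generate v^-1; exists (f, l).
pose f v := (fl v).1; pose l v := f v (fl v).2.
have f1 v : Mod1 g (f v) by have [] := flP v.
have thE v x : th v x = aut_bwd (f v) ((l v)^-1 * x * l v).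
  have [_ /(_ (th v x))] := flP v; rewrite -(th_mul thM) mulVg (th_one thM) => E.
  rewrite [in RHS]E /l -/(f v) !autM (morphV (@autM _ (f v))) !mulgA mulVg mul1g.
  by rewrite mulgVK autK.
pose a v := b \o aut_bwd (f v).
have am v : hom_on H (a v) by exact: (hom_aut chH (aut_inv (f v))).
pose orbit v := H1_act (f v) (H1_class H c).
have orbit_s v : orbit v \in s.
  have : [set` s] (orbit v) by rewrite -sE; exists (f v).
  by [].
have orbit_lt v : (index (orbit v) s < size s)%N by rewrite index_mem.
apply: (@finite_index_of _ _ (fun v => (Ordinal (orbit_lt v), cls (l v)))) => // v v'.
move=> [/(congr1 (nth set0 s))]; rewrite !nth_index // => orb_eq /clsE Hl.
have aa' x : H x -> a v x = a v' x.
  move=> Hx; have dif_m : hom_on H (fun x => -1 * a v' x + a v x)%R by exact: hom_on_lin.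
  suff /(_ x Hx) E : forall x, H x -> (-1 * a v' x + a v x = 0)%R by lra.
  apply: (w_nd _ dif_m) => e em; rewrite w_anti // wr //.
  have [e0 He0] : exists e0, orbit v e0.
    exists (chain1_map (f v) c); exists c => //; split=> //.
    by rewrite subrr; exact: B1_0.
  have He0' := He0; rewrite orb_eq in He0'; move: He0 He0'.
  rewrite /orbit !(H1_act_dual sgH fiH chH w_inv bm Hc bc) //.
  by move=> [_ /(_ e em) ->] [_ /(_ e em) ->]; ring.
have thE' y : H y -> b (th v y) = b (th v' y).
  move=> Hy; rewrite !thE -/(a v _) -/(a v' _).
  have cH z k : H z -> H (k^-1 * z * k).
    by move=> Hz; rewrite -{2}[k]invgK; exact: characteristic_conj.
  transitivity (a v' ((l v)^-1 * y * l v)); first exact: (aa' _ (cH _ _ Hy)).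
  set h := l v * (l v')^-1; pose h' := (l v')^-1 * h * l v'.
  have Hh' : H h' by exact: cH.
  have -> : (l v)^-1 * y * l v = h'^-1 * ((l v')^-1 * y * l v') * h'.
    by rewrite /h' /h !invgM !invgK !mulgA !(mulgVK, mulgK, mulVg, mul1g).
  have Hy' := cH y (l v') Hy; have HVh' := HV _ Hh'.
  rewrite (am v' _ _ (HM _ _ HVh' Hy') Hh') (am v' _ _ HVh' Hy').
  by rewrite (hom_onV sgH (am v') Hh') addrC addNKr.
by move=> x Hx; rewrite (th_mul thM) (thE' _ (Hth _ _ Hx)) -(th_mul thM) mulgV (th_one thM).
Qed.

(** The kernel of a + c lambda on the semidirect product of H by the stabilizer
    of a, where lambda is the total exponent of the stable letters: a factor c
    that is large enough makes it finitely generated on the mapping torus of one element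
    of the stabilizer, by the dynamics of the windows, and then on the whole
    product, which has finitely many further generators. *)
Lemma stabilizer_fibers (H : set K) (St : set F) (a : K -> int) :
  subgroup H -> finite_index H -> characteristic H -> subgroup St -> finite_index St ->
  (forall x y, H x -> H y -> a (x * y) = (a x + a y)%R) ->
  (exists2 k, H k & a k = 1%R) ->
  (forall v x, St v -> H x -> a (th v x) = a x) ->
  virtually_algebraically_fibers S.
Proof.
move=> sgH fiH chH sgSt fiSt aM [k Hk ak] aSt.
have [H1 HM HV] := sgH; have [St1 StM StV] := sgSt.
have thM := monodromyM u d.
have Hth v x : H x -> H (th v x) by move=> Hx; apply/(characteristic_aut chH).
have a1 : a 1 = 0%R by apply: (addrI (a 1)); rewrite -aM // mulg1 addr0.
have aV x : H x -> a x^-1 = (- a x)%R.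
  by move=> Hx; apply/eqP; rewrite -addr_eq0 -aM ?mulVg ?a1 //; exact: HV.
have aZ n : a (zpow k n) = n.
  elim/int_ind: n => [//|n IH|n IH].
    by rewrite -addn1 PoszD zpowS aM ?IH ?ak //; exact: subgroupZ.
  have := aM _ _ (subgroupZ (- n.+1%:Z)%R sgH Hk) Hk.
  rewrite -zpowS ak (_ : (- n.+1%:Z + 1)%R = (- n%:Z)%R); last by lia.
  by rewrite IH; lia.
pose lam : F -> int := potential (fun _ _ => 1%R).
have lamM : {morph lam : x y / (x * y) >-> (x + y)%R}.
  move=> x y; apply: potential_translate; first exact: potential1.
  by move=> p b; rewrite /lam !potentialS addrC addKr addrC addKr.
have lamX n : lam (free_gen true ^+ n) = Posz n.
  elim: n => [|n IH]; first exact: potential1.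
  by rewrite expgSr /lam potentialS -/lam IH; lia.
have [e e_gt0 Ste] := finite_index_power (free_gen true) sgSt fiSt.
set t1 := free_gen true ^+ e in Ste.
(* Generators of H, of which all but k lie in the kernel of a. *)
have [r [s sH]] := subgroup_generators sgH fiH.
pose D := [set s i * (zpow k (a (s i)))^-1 | i in [set: 'I_r]].
have Hs i : H (s i) by rewrite -sH; apply: generated_sub; exists i.
have HZ n : H (zpow k n) by exact: subgroupZ.
have HD x : D x -> H x /\ a x = 0%R.
  move=> [i _ <-]; split; first by apply: (HM) => //; exact: HV.
  by rewrite aM ?aV ?aZ ?subrr //; exact: HV.
have DH : generated (k |` D) = H.
  apply/seteqP; split.
    by apply: generated_min => // x [->|/HD[]].
  have [g1 gM gV] := generated_subgroup (k |` D).
  rewrite -{1}sH; apply: generated_min; first exact: generated_subgroup.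
  move=> _ [i _ <-]; rewrite -[s i](mulgVK (zpow k (a (s i)))); apply: (gM).
    by apply: generated_sub; right; exists i.
  apply: (subgroupZ _ (generated_subgroup _)).
  by apply: generated_sub; left.
have inlM := semi_inlM (monodromyM u d).
pose a' (x : S) := a x.1.
have inlH : generated (inl_ k |` inl_ @` D) = inl_ @` H.
  by rewrite -DH generated_image // image_setU image_set1.
have tor_conj v x : inr_ v * inl_ x * (inr_ v)^-1 = inl_ (th v x).
  by rewrite semi_conj /= mul1g invg1 mulg1.
have inrM := semi_inrM (monodromyM u d).
have [||||||L LP] := @torus_kernel S (inl_ k) (inr_ t1) (inl_ @` D) a'.
- by apply: finite_image; exact: finite_image finite_finset.
- by rewrite inlH => _ _ /set_mem[x Hx <-] /set_mem[y Hy <-]; rewrite -inlM /a' /= aM.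
- exact: ak.
- by move=> _ [x /HD[_ ax] <-].
- rewrite inlH => _ [x Hx <-]; rewrite tor_conj; split; last exact: aSt.
  by exists (th t1 x) => //; exact: Hth.
- rewrite inlH => _ [x Hx <-]; rewrite -{2 4}[inr_ t1]invgK -(morphV inrM) tor_conj.
  split; last by apply: aSt => //; exact: StV.
  by exists (th t1^-1 x) => //; exact: Hth.
pose f (x : S) := (a x.1 + L.+1%:Z * lam x.2)%R.
pose HS := [set x : S | H x.1 /\ St x.2].
have HSE (x y : S) : H (x.1^-1 * y.1) -> St (x.2^-1 * y.2) -> HS (x^-1 * y).
  by move=> Hxy Sxy; rewrite semiM semiV /= /HS /= -autM; split=> //; exact: Hth.
have sgHS : subgroup HS.
  split=> [|x y [Hx Sx] [Hy Sy]|x [Hx Sx]]; first by split.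
    by split; [apply: (HM) => //; exact: Hth | exact: StM].
  by split; [apply: Hth; exact: HV | exact: StV].
have fM x y : HS x -> HS y -> f (x * y) = (f x + f y)%R.
  move=> [Hx Sx] [Hy Sy]; rewrite /f semiM /= lamM aM ?aSt //; last exact: Hth.
  by ring.
have f1 : f 1 = 0%R.
  by apply: (addrI (f 1)); have [HS1 _ _] := sgHS; rewrite -fM // mulg1 addr0.
have fV x : HS x -> f x^-1 = (- f x)%R.
  move=> Hx; have [_ _ HSV] := sgHS; apply/eqP; rewrite -addr_eq0 -fM ?mulVg ?f1 //.
  exact: HSV.
have lam1 : lam 1 = 0%R by exact: potential1.
have fr v : f (inr_ v) = (L.+1%:Z * lam v)%R by rewrite /f /= a1 add0r.
have fl x : f (inl_ x) = a x by rewrite /f /= lam1 mulr0 addr0.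
have HSl x : H x -> HS (inl_ x) by move=> Hx; split; [exact: Hx | exact: St1].
exists HS; split=> //.
  have [n [cls [_ [_ clsE]]]] := finite_indexP sgH fiH.
  have [n' [cls' [_ [_ clsE']]]] := finite_indexP sgSt fiSt.
  apply: (@finite_index_of _ _ (fun x : S => (cls (x^-1).1^-1, cls' (x^-1).2^-1))) => //.
  move=> x y [c1 c2]; rewrite -[x]invgK; apply: HSE.
    by move/clsE: c1; rewrite [X in H (_ * X)]invgK.
  by move/clsE': c2; rewrite [X in St (_ * X)]invgK.
exists f; split=> // [n|].
  by exists (inl_ (zpow k n)); [exact: HSl | rewrite fl aZ].
(* The kernel is generated by the kernel on the mapping torus of t1 and by lifts
   of the generators of the stabilizer. *)
have M_gt : (L%:Z < f (inr_ t1))%R by rewrite fr /t1 lamX; nia.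
have [B finB [BK Bgen]] := LP _ M_gt.
have fgF : finitely_generated [set: F].
  exists (range (@free_gen bool)); first exact: finite_image finite_finset.
  apply/seteqP; split=> // v _; apply: (free_group_ind (generated_subgroup _)) => b.
  by apply: generated_sub; exists b.
have [T finT TE] := finite_index_fg fgF sgSt fiSt.
have T'E : generated (t1 |` T) = St.
  apply/seteqP; split.
    by apply: generated_min => // v [->//|Tv]; rewrite -TE; exact: generated_sub.
  rewrite -{1}TE; apply: generated_min; first exact: generated_subgroup.
  by move=> v Tv; apply: generated_sub; right.
have T'S v : (t1 |` T) v -> St v by rewrite -T'E; exact: generated_sub.
pose lft v := inl_ (zpow k (- f (inr_ v))%R) * inr_ v.
have lft2 v : (lft v).2 = v by rewrite /lft semiM /= mul1g.
have lftN v : St v -> HS (lft v) /\ f (lft v) = 0%R.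
  move=> Sv; have HSk : HS (inl_ (zpow k (- f (inr_ v))%R)) by exact: HSl.
  have HSr : HS (inr_ v) by split; [exact: H1 | exact: Sv].
  split; first by have [_ + _] := sgHS; apply.
  by rewrite /lft fM // fl aZ addNr.
pose N := [set x | HS x /\ f x = 0%R].
have [HS1 HSM HSV] := sgHS.
have sgN : subgroup N.
  split=> [|x y [Hx fx] [Hy fy]|x [Hx fx]]; first by split.
    by split; [exact: HSM | rewrite fM // fx fy addr0].
  by split; [exact: HSV | rewrite fV // fx oppr0].
have BN : B `<=` N.
  move=> z /BK[]; rewrite inlH => -[x Hx <-] ax; split; last by rewrite fl.
  exact: HSl.
pose U := lft @` (t1 |` T) `|` B.
exists U.
  by rewrite finite_setU; split=> //; apply: finite_image; rewrite finite_setU; split=> //; exact: finite_set1.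
have UN : generated U `<=` N.
  apply: generated_min => // x [[v T'v <-]|/BN//].
  by have [] := lftN v (T'S _ T'v).
have [U1 UM UV] := generated_subgroup U.
apply/seteqP; split=> // x [[Hx Sx] fx].
have [y Uy yx] : exists2 y, generated U y & y.2 = x.2.
  have : ((fun x : S => x.2) @` generated U) x.2.
    rewrite (generated_image (@semi_sndM _ _ _ _)).
    have : generated (t1 |` T) x.2 by rewrite T'E.
    apply: generated_min; first exact: generated_subgroup.
    move=> v T'v; apply: generated_sub; exists (lft v); last exact: lft2.
    by left; exists v.
  by case=> y Uy yx; exists y.
have [HSy fy] := UN _ Uy.
have HSxy : HS (x * y^-1) by apply: (HSM) => //; exact: HSV.
have xyE : x * y^-1 = inl_ (x * y^-1).1.
  have xy1 : (x * y^-1).2 = 1 by rewrite semiM semiV /= yx mulgV.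
  by rewrite [LHS]semi_split xy1 (morph1 inrM) mulg1.
have fxy : f (x * y^-1) = 0%R by rewrite fM ?fV ?fx ?fy //; exact: HSV.
rewrite -[x](mulgVK y); apply: (UM) => //.
have : generated ((zpow (inl_ k) (- f (inr_ t1))%R * inr_ t1) |` B) (x * y^-1).
  apply: Bgen; first by rewrite inlH xyE; exists (x * y^-1).1 => //; have [] := HSxy.
  by have := fxy; rewrite {1}xyE fl.
apply: generated_min; first exact: generated_subgroup.
move=> z [->|Bz]; apply: generated_sub; last by right.
by left; exists t1; [left | rewrite /lft (morph_zpow inlM)].
Qed.

(** The homomorphism dual to a nonzero class with a finite orbit is nonzero and
    has a stabilizer of finite index, which yields a fibering. *)
Lemma NFO_of_not_fibering : ~ virtually_algebraically_fibers S -> NFO g.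
Proof.
move=> nfib H sgH fiH chH _ [c Hc <-] c0 fin_orbit; apply: nfib.
have [H1 HM HV] := sgH.
have [w [wl wr w_eq [w_nd w_anti w_inv]]] := characteristic_form sgH fiH chH.
have [r [s sH]] := subgroup_generators sgH fiH.
have [b bm bc] := form_represents_chain sgH sH wl wr w_eq w_nd Hc.
have b0 : ~ (forall x, H x -> b x = 0%R).
  move=> b0; apply: c0; apply: H1_class_eq0 => //.
  apply: (boundaryP sgH fiH) => // a am; rewrite -bc //.
  have -> : w a b = w a (fun x => -1 * b x + b x)%R.
    apply: w_eq => // [|x Hx]; first exact: hom_on_lin.
    by rewrite b0 //; ring.
  by rewrite wr //; ring.
have [sgSt fiSt] := stabilizer_finite_index sgH fiH chH w_nd w_anti wr w_inv bm Hc bc fin_orbit.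
have [a [q [q0 [a_surj bE]]]] := integral_character sgH sH bm b0.
have a_inj x y : H x -> H y -> b x = b y -> a x = a y.
  by move=> Hx Hy; rewrite !bE // => /(mulfI q0) /intr_inj.
apply: (stabilizer_fibers sgH fiH chH sgSt fiSt (a := a)) => // [x y Hx Hy|v x Sv Hx].
  apply: (@intr_inj rat); apply: (mulfI q0); rewrite -bE ?bm //; last exact: HM.
  by rewrite intrD mulrDr -!bE.
by apply: a_inj => //; [exact/(characteristic_aut chH) | exact: Sv].
Qed.

End Fibering.

Theorem proposition3p6 (g : nat) (hg : (3 <= g)%N)
    (upsilon delta : aut (surface_group g))
    (upsilon_Mod : Mod g (out upsilon))
    (upsilon_order : has_order (out upsilon) (4 * g + 2)%N)
    (delta_twist : nonseparating_dehn_twist delta)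
    (generate : generated [set out upsilon; out (delta * upsilon * delta^-1)]
                = Mod g) :
  NFO g <-> ~ virtually_algebraically_fibers (amalgam_along upsilon delta).
Proof.
have [f [f' [fM f'M fK f'K]]] := amalgam_iso upsilon delta.
split=> [nfo fib|nfib].
  apply: (fibering_not_NFO generate) nfo.
  exact: (virtually_algebraically_fibers_iso fM f'M fK f'K).
apply: (NFO_of_not_fibering generate) => fib; apply: nfib.
exact: (virtually_algebraically_fibers_iso f'M fM f'K fK).
Qed.
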